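(* Consider the random process $\{\boldsymbol{x}(t)\}_{t\in\mathbb{Z}_{\ge 0}}$ in $[0,1]^{|\mathcal{V}|}$ defined by $$\boldsymbol{x}(t+1)=\boldsymbol{\Lambda}\boldsymbol{P}(t)\boldsymbol{x}(t)+(\boldsymbol{I}-\boldsymbol{\Lambda})\boldsymbol{\eta}(t),\qquad \boldsymbol{\eta}(t)=\boldsymbol{\eta}^0+\boldsymbol{\eta}^{\mathrm{nc}}(t)+\boldsymbol{u}(t),$$ where $\boldsymbol{P}(t)=\boldsymbol{P}$ with probability $\alpha$ and $\boldsymbol{P}(t)=\boldsymbol{I}$ with probability $1-\alpha$, together with the process of acceptance variables $\{\boldsymbol{y}(t)\}_{t\in\mathbb{Z}_{\ge0}}$ in $\{0,1\}^{|\mathcal{V}|}$. Suppose $\boldsymbol{u}(t)=\boldsymbol{0}$ for all $t\in\mathbb{Z}_{\ge0}$, and that Assumptions (Noise), (Acceptance) and (Topology), as spelled out in the context, hold. Let $\boldsymbol{x}_\infty$ denote the limit in distribution of $\boldsymbol{x}(t)$, and $\boldsymbol{x}^\star=(\boldsymbol{I}-\boldsymbol{\Lambda}\overline{\boldsymbol{P}})^{-1}(\boldsymbol{I}-\boldsymbol{\Lambda})\boldsymbol{\eta}^0$ with $\overline{\boldsymbol{P}}=(1-\alpha)\boldsymbol{I}+\alpha\boldsymbol{P}$. Then: 1. $\{\boldsymbol{y}(t)\}_{t\in\mathbb{Z}_{\ge0}}$ converges in distribution to a random vector $\boldsymbol{y}_\infty$ that is distributed as a Bernoulli distribution with parameter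 $\boldsymbol{x}_\infty$. In particular, $\mathbb{E}[\boldsymbol{y}_\infty]=\boldsymbol{x}^\star$. 2. The process $\{\boldsymbol{y}(t)\}_{t\in\mathbb{Z}_{\ge0}}$ is ergodic.
   Context: Model. $\mathcal{V}$ is a finite set of agents with $|\mathcal{V}|\ge 3$; $\boldsymbol{P}\in\mathbb{R}^{|\mathcal{V}|\times|\mathcal{V}|}$ is a row-stochastic (nonnegative entries, $\boldsymbol{P}\boldsymbol{1}=\boldsymbol{1}$) influence matrix; the directed graph has an edge $(v,w)$ when $P_{vw}>0$ ($v$ is influenced by $w$). $\boldsymbol{\Lambda}$ is diagonal with entries $\lambda_v\in[0,1]$, $\alpha\in[0,1]$, $\boldsymbol{\eta}^0\in[0,1]^{|\mathcal{V}|}$ is a deterministic vector of individual biases, $\boldsymbol{\eta}^{\mathrm{nc}}(t)$ is a random uncontrollable input and $\boldsymbol{u}(t)$ a control input, with $\boldsymbol{\eta}(t)\in[0,1]^{|\mathcal{V}|}$. The initial condition is $\boldsymbol{x}(0)\in[0,1]^{|\mathcal{V}|}$. The matrices $\boldsymbol{P}(t)$ are drawn independently over $t$, independently of the inputs $\boldsymbol{\eta}^{\mathrm{nc}}$ and of the initial condition. Assumption (Noise): the vectors $\boldsymbol{\eta}^{\mathrm{nc}}(t)$, $t\in\mathbb{Z}_{\ge0}$, are independent and identically distributed over $t$, with components independent across agents, zero mean and covariance $\mathrm{diag}(\sigma_v^2)_{v\in\mathcal{V}}$, and $\boldsymbol{\eta}^{\mathrm{nc}}(t)$ is independent of the state $\boldsymbol{x}(t)$.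 Assumption (Acceptance): for all $t\in\mathbb{Z}_{\ge0}$ and $v\in\mathcal{V}$, $\mathbb{P}(y_v(t)=1\mid\boldsymbol{x}(t))=x_v(t)$ and $\mathbb{P}(y_v(t)=0\mid\boldsymbol{x}(t))=1-x_v(t)$. Assumption (Topology): for every $v\in\mathcal{V}$ there exists a path in the graph from $v$ to some node $s\in\mathcal{V}$ with $\lambda_s<1$. ''Bernoulli with parameter $\boldsymbol{x}_\infty$'' means that, conditionally on $\boldsymbol{x}_\infty$, each component satisfies $\mathbb{P}(y_{\infty,v}=1\mid\boldsymbol{x}_\infty)=x_{\infty,v}$. Ergodicity: a process $\{\boldsymbol{y}(t)\}_{t\in\mathbb{Z}_{\ge0}}$ is ergodic if there is a random variable $\boldsymbol{y}_\infty$ such that $\lim_{t\to\infty}\frac1t\sum_{\ell=0}^{t-1}\boldsymbol{y}(\ell)=\mathbb{E}[\boldsymbol{y}_\infty]$ almost surely (here with the $\boldsymbol{y}_\infty$ of item 1).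
   Formalization: Added: given x(0..t) and y(0..t-1), the y_v(t) are independent Bernoulli(x_v(t)) across agents (Acceptance alone allows one uniform reused for all t, so no ergodicity); and if α=0 then all λ_v<1, since otherwise I−ΛP̄ is singular and x* is undefined. *)

(* Defs.v *)
From mathcomp Require Export all_boot all_order all_algebra.
From mathcomp Require Export all_classical all_reals all_analysis.
Export Order.TTheory GRing.Theory Num.Theory.
Export numFieldNormedType.Exports.

Set Implicit Arguments.
Unset Strict Implicit.
Unset Printing Implicit Defensive.

Global Open Scope classical_set_scope.
Global Open Scope ring_scope.

Definition random_mx d (T : measurableType d) (R : realType) m n
    (X : T -> 'M[R]_(m, n)) : Prop :=
  forall i j, measurable_fun [set: T] (fun w => X w i j).

Definition sigma_entry (T : Type) (R : realType) m n
    (X : T -> 'M[R]_(m, n)) i j : set (set T) :=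
  preimage_set_system [set: T] (fun w => X w i j) (@measurable _ R).

(* sigma(X); for [X := id] this is the Borel sigma-algebra of the space of
   matrices, seen as a finite product of copies of R. *)
Definition sigma_mx (T : Type) (R : realType) m n
    (X : T -> 'M[R]_(m, n)) : set (set T) :=
  <<s \bigcup_(ij in [set: 'I_m * 'I_n]) sigma_entry X ij.1 ij.2 >>.

Definition sigma_proc (T : Type) (R : realType) m n (D : set nat)
    (X : nat -> T -> 'M[R]_(m, n)) : set (set T) :=
  <<s \bigcup_(t in D) sigma_mx (X t) >>.

Definition sigma_join (T : Type) (F G : set (set T)) : set (set T) :=
  <<s F `|` G >>.

Definition same_law d (T : measurableType d) (R : realType)
    (Pr : probability T R) m n (X Y : T -> 'M[R]_(m, n)) : Prop :=
  forall A, sigma_mx (@id 'M[R]_(m, n)) A -> Pr (X @^-1` A) = Pr (Y @^-1` A).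

Definition coord (T : Type) (R : realType) n (X : T -> 'cV[R]_n) (v : 'I_n) :
    T -> R := fun w => X w v 0.

Definition independent_pair d (T : measurableType d) (R : realType)
    (Pr : probability T R) (F G : set (set T)) : Prop :=
  forall A B, F A -> G B -> Pr (A `&` B) = (Pr A * Pr B)%E.

Definition independent_family d (T : measurableType d) (R : realType)
    (Pr : probability T R) (I : eqType) (F : I -> set (set T)) : Prop :=
  forall (s : seq I) (E : I -> set T), uniq s ->
    (forall i, i \in s -> F i (E i)) ->
    Pr (\big[setI/setT]_(i <- s) E i) = (\prod_(i <- s) Pr (E i))%E.

(* [h] is a version of the conditional probability of the event [E] given the
   sub-sigma-algebra [G]. *)
Definition is_cond_prob d (T : measurableType d) (R : realType)
    (Pr : probability T R) (E : set T) (G : set (set T)) (h : T -> R) : Prop :=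
  [/\ forall B : set R, measurable B -> G (h @^-1` B),
      Pr.-integrable [set: T] (EFin \o h) &
      forall A, G A -> Pr (E `&` A) = (\int[Pr]_(w in A) (h w)%:E)%E].

(* The limit may live on a probability space other than the one of the
   sequence. *)
Definition cvg_in_distribution d (T : measurableType d) (R : realType)
    (Pr : probability T R) d' (T' : measurableType d') (Pr' : probability T' R)
    n (X : nat -> T -> 'cV[R]_n) (Xoo : T' -> 'cV[R]_n) : Prop :=
  forall f : 'cV[R]_n -> R, continuous f -> (exists M : R, forall z, `|f z| <= M) ->
    ('E_Pr[f \o X t])%E @[t --> \oo] --> ('E_Pr'[f \o Xoo])%E.

Definition mean_vec d (T : measurableType d) (R : realType)
    (Pr : probability T R) n (X : T -> 'cV[R]_n) : 'cV[R]_n :=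
  \col_v fine ('E_Pr[coord X v])%E.

Definition ergodic_with d (T : measurableType d) (R : realType)
    (Pr : probability T R) d' (T' : measurableType d') (Pr' : probability T' R)
    n (Y : nat -> T -> 'cV[R]_n) (Yoo : T' -> 'cV[R]_n) : Prop :=
  {ae Pr, forall w,
    (t%:R^-1 *: \sum_(l < t) Y l w) @[t --> \oo] --> mean_vec Pr' Yoo}.

Definition unit_box (R : realType) n (z : 'cV[R]_n) : Prop :=
  forall v, 0 <= z v 0 <= 1.

Definition binary_vec (R : realType) n (z : 'cV[R]_n) : Prop :=
  forall v, z v 0 = 0 \/ z v 0 = 1.

Definition row_stochastic (R : realType) n (P : 'M[R]_n) : Prop :=
  (forall v w, 0 <= P v w) /\ P *m const_mx 1 = const_mx 1 :> 'cV[R]_n.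

Definition mean_influence (R : realType) n (alpha : R) (P : 'M[R]_n) : 'M[R]_n :=
  (1 - alpha) *: 1%:M + alpha *: P.

Definition x_star (R : realType) n (alpha : R) (P : 'M[R]_n) (lam : 'rV[R]_n)
    (eta0 : 'cV[R]_n) : 'cV[R]_n :=
  invmx (1%:M - diag_mx lam *m mean_influence alpha P)
    *m ((1%:M - diag_mx lam) *m eta0).

(* The law [alpha * dirac P + (1 - alpha) * dirac I] through its point masses;
   the two atoms coincide when [P] is the identity. *)
Definition gossip_law d (T : measurableType d) (R : realType)
    (Pr : probability T R) n (alpha : R) (P : 'M[R]_n) (M : T -> 'M[R]_n) : Prop :=
  forall Q, Pr [set w | M w = Q] =
    (alpha * (Q == P)%:R + (1 - alpha) * (Q == 1%:M)%:R)%:E.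

Definition noise_assumption d (T : measurableType d) (R : realType)
    (Pr : probability T R) n (sigma : 'I_n -> R)
    (eta_nc x : nat -> T -> 'cV[R]_n) : Prop :=
  [/\ independent_family Pr (fun t => sigma_mx (eta_nc t))
        /\ (forall t, same_law Pr (eta_nc t) (eta_nc 0%N)),
      forall t, independent_family Pr (fun v => sigma_entry (eta_nc t) v 0),
      forall t v, ('E_Pr[coord (eta_nc t) v] = 0)%E,
      forall t v1 v2,
        covariance Pr (coord (eta_nc t) v1) (coord (eta_nc t) v2) =
        (diag_mx (\row_v sigma v ^+ 2) v1 v2)%:E &
      forall t, independent_pair Pr (sigma_mx (eta_nc t)) (sigma_mx (x t))].

Definition acceptance_assumption d (T : measurableType d) (R : realType)
    (Pr : probability T R) n (x y : nat -> T -> 'cV[R]_n) : Prop :=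
  forall t v,
    is_cond_prob Pr [set w | y t w v 0 = 1] (sigma_mx (x t))
      (coord (x t) v) /\
    is_cond_prob Pr [set w | y t w v 0 = 0] (sigma_mx (x t))
      (fun w => 1 - x t w v 0).

(* The marginal conditional laws above do not determine the joint law of the
   acceptances: given x(0), ..., x(t) and y(0), ..., y(t-1), the decisions
   taken at time t are drawn independently across the agents, each one with
   its conditional probability given x(t). *)
Definition independent_acceptances d (T : measurableType d) (R : realType)
    (Pr : probability T R) n (x y : nat -> T -> 'cV[R]_n) : Prop :=
  forall t (b : 'I_n -> bool),
    is_cond_prob Pr [set w | forall v, y t w v 0 = (b v)%:R]
      (sigma_join (sigma_proc [set s | (s <= t)%N] x)
                  (sigma_proc [set s | (s < t)%N] y))
      (fun w => \prod_v (if b v then x t w v 0 else 1 - x t w v 0)).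

Definition topology_assumption (R : realType) n (P : 'M[R]_n)
    (lam : 'rV[R]_n) : Prop :=
  forall v, exists2 s, connect [rel i j | 0 < P i j] v s & lam 0 s < 1.

Definition bernoulli_given d (T : measurableType d) (R : realType)
    (Pr : probability T R) n (Y X : T -> 'cV[R]_n) : Prop :=
  (forall w, binary_vec (Y w)) /\
  forall v, is_cond_prob Pr [set w | Y w v 0 = 1] (sigma_mx X)
    (coord X v).

(* Main.v *)
(** The innovation x(t+1) - L Pbar x(t) - (I - L) eta0 is the sum of
    L (P(t) - Pbar) x(t) and (I - L) eta_nc(t), two bounded sequences that are
    uncorrelated in time; so is y(t) - x(t), by the conditional independence of the
    acceptances. A strong law of large numbers for bounded uncorrelated variables
    gives (I - L Pbar) (average of x) -> (I - L) eta0 and (average of y) - (average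
    of x) -> 0 almost surely. The matrix I - L Pbar is invertible by a maximum
    principle along the paths given by the topology assumption, which proves
    ergodicity.

    For the convergence in distribution, let xi be the process driven by the same
    inputs as x but started from 0. The mean of x - xi >= 0 follows the substochastic
    recursion u -> L Pbar u, hence tends to 0. As the inputs are i.i.d., xi(t) has
    the law of the backward composition of the first t random affine maps applied
    to 0. These maps are monotone and preserve the unit box, so the backward
    compositions increase with t to a limit x_oo, on the same probability space.
    Adjoining independent Bernoulli choices with parameter x_oo yields y_oo, and the
    law of y(t) converges because the weights of its atoms are the expectations of
    polynomials in x(t). *)

From HB Require Import structures.
Require Import Defs.
From mathcomp Require Import measurable_realfun ring lra.

Set Implicit Arguments.
Unset Strict Implicit.
Unset Printing Implicit Defensive.

Require Import Defs.
From mathcomp Require Import ring lra.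
(** * Expectation of bounded random variables *)

Section BoundedRandomVariables.
Context d (T : measurableType d) (R : realType).
Implicit Types (X Y Z : T -> R).

(** The initial state is not assumed independent of the noise process as a whole, so the state is
    not treated as a Markov chain. All inputs, future noise included, belong to the history of time
    [t]; the only fresh randomness at time [t] is whether [P] is applied. In the averages and in the
    mean recursion the noise enters additively: its mean and its correlations in time suffice, and
    it is never multiplied by the state.

    Starting from 0 serves two ends. It removes the initial state from the law of the process, and,
    0 being the least point of the box, the gap to [x] is nonnegative, so its mean is its L1 norm
    and a recursion on first moments is enough. Time is reversed because the forward process does
    not converge pathwise in general. Reversal equates laws at each fixed [t] only, which is all
    that convergence in distribution involves.

    When [alpha] is 0 the mean influence matrix is the identity whatever the graph, so paths cannot
    help and every node must have [lam < 1] by itself: this is [alpha_nondeg]. *)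

Definition bounded_rv X := measurable_fun [set: T] X /\ exists M : R, forall w, `|X w| <= M.

Lemma bounded_rv_cst c : bounded_rv (fun=> c).
Proof. by split; [exact: measurable_cst | exists `|c|]. Qed.

Lemma bounded_rvD X Y : bounded_rv X -> bounded_rv Y -> bounded_rv (fun w => X w + Y w).
Proof.
move=> [mX [M XM]] [mY [N YN]]; split; first exact: measurable_funD.
by exists (M + N) => w; rewrite (le_trans (ler_normD _ _))// lerD.
Qed.

Lemma bounded_rvM X Y : bounded_rv X -> bounded_rv Y -> bounded_rv (fun w => X w * Y w).
Proof.
move=> [mX [M XM]] [mY [N YN]]; split; first exact: measurable_funM.
by exists (M * N) => w; rewrite normrM ler_pM.
Qed.

Lemma bounded_rvZ c X : bounded_rv X -> bounded_rv (fun w => c * X w).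
Proof. by apply: bounded_rvM; exact: bounded_rv_cst. Qed.

Lemma bounded_rvB X Y : bounded_rv X -> bounded_rv Y -> bounded_rv (fun w => X w - Y w).
Proof.
move=> bX [mY [M YM]]; apply: bounded_rvD => //; split.
  exact: measurableT_comp.
by exists M => w; rewrite normrN.
Qed.

Lemma bounded_rv_norm X : bounded_rv X -> bounded_rv (fun w => `|X w|).
Proof.
move=> [mX [M XM]]; split; first exact: measurableT_comp.
by exists M => w; rewrite normr_id.
Qed.

Lemma bounded_rv_sum (I : Type) (r : seq I) (P : pred I) (F : I -> T -> R) :
  (forall i, P i -> bounded_rv (F i)) -> bounded_rv (fun w => \sum_(i <- r | P i) F i w).
Proof.
move=> FB; elim: r => [|i r IH].
  under eq_fun do rewrite big_nil; exact: bounded_rv_cst.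
under eq_fun do rewrite big_cons.
by case Pi : (P i) => //; apply: bounded_rvD => //; exact: FB.
Qed.

Lemma bounded_rv_prod (I : Type) (r : seq I) (F : I -> T -> R) :
  (forall i, bounded_rv (F i)) -> bounded_rv (fun w => \prod_(i <- r) F i w).
Proof.
move=> FB; elim: r => [|i r IH].
  under eq_fun do rewrite big_nil; exact: bounded_rv_cst.
under eq_fun do rewrite big_cons.
exact: bounded_rvM.
Qed.

Lemma bounded_rv_indic A : measurable A -> bounded_rv (\1_A : T -> R).
Proof.
move=> mA; split; first exact: measurable_indic.
by exists 1 => w; rewrite indicE normr_nat lern1 leq_b1.
Qed.

Lemma bounded_rv_unit X : measurable_fun setT X -> (forall w, 0 <= X w <= 1) ->
  bounded_rv X.
Proof.
by move=> mX X01; split => //; exists 1 => w; have /andP[? ?] := X01 w; rewrite ger0_norm.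
Qed.

Variable Pr : probability T R.

(** As a real number, an infinite integral would silently become 0. The calculus rules therefore run
    on [bounded_rv], a class which, unlike integrability, is closed under products. *)
Definition Ex X : R := \int[Pr]_w X w.

Lemma bounded_rv_integrable X : bounded_rv X -> Pr.-integrable setT (EFin \o X).
Proof.
move=> [mX [M XM]].
apply: (@le_integrable _ _ _ Pr setT measurableT _ (EFin \o cst M)) => //.
- exact/measurable_EFinP.
- by move=> w _; rewrite /= lee_fin (le_trans (XM w))// ler_norm.
- exact: finite_measure_integrable_cst.
Qed.
#[local] Hint Resolve bounded_rv_integrable : core.

Lemma ExE X : bounded_rv X -> (\int[Pr]_w (X w)%:E = (Ex X)%:E)%E.
Proof.
move=> bX; rewrite /Ex /Rintegral fineK//.
by apply: integrable_fin_num => //; exact: bounded_rv_integrable.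
Qed.

Lemma expectation_Ex X : bounded_rv X -> ('E_Pr[X] = (Ex X)%:E)%E.
Proof. by move=> bX; rewrite unlock ExE. Qed.

Lemma ExD X Y : bounded_rv X -> bounded_rv Y -> Ex (fun w => X w + Y w) = Ex X + Ex Y.
Proof. by move=> bX bY; rewrite /Ex RintegralD//; exact: bounded_rv_integrable. Qed.

Lemma ExB X Y : bounded_rv X -> bounded_rv Y -> Ex (fun w => X w - Y w) = Ex X - Ex Y.
Proof. by move=> bX bY; rewrite /Ex RintegralB//; exact: bounded_rv_integrable. Qed.

Lemma ExZ c X : bounded_rv X -> Ex (fun w => c * X w) = c * Ex X.
Proof. by move=> bX; rewrite /Ex RintegralZl//; exact: bounded_rv_integrable. Qed.

Lemma Ex_cst c : Ex (fun=> c) = c.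
Proof.
by rewrite /Ex Rintegral_cst// [X in fine X](_ : _ = 1%E) ?mulr1//; exact: probability_setT.
Qed.

Lemma Ex_sum (I : Type) (r : seq I) (P : pred I) (F : I -> T -> R) :
  (forall i, P i -> bounded_rv (F i)) ->
  Ex (fun w => \sum_(i <- r | P i) F i w) = \sum_(i <- r | P i) Ex (F i).
Proof.
move=> FB; elim: r => [|i r IH].
  by under eq_fun do rewrite big_nil; rewrite Ex_cst big_nil.
under eq_fun do rewrite big_cons.
rewrite big_cons; case: ifP => // Pi.
by rewrite ExD ?IH//; [exact: FB | exact: bounded_rv_sum].
Qed.

Lemma Ex_le X Y : bounded_rv X -> bounded_rv Y -> (forall w, X w <= Y w) -> Ex X <= Ex Y.
Proof. by move=> bX bY XY; apply: le_Rintegral => //; exact: bounded_rv_integrable. Qed.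

Lemma Ex_ge0 X : (forall w, 0 <= X w) -> 0 <= Ex X.
Proof. by move=> X0; apply: Rintegral_ge0. Qed.

Lemma Ex_norm X : bounded_rv X -> `|Ex X| <= Ex (fun w => `|X w|).
Proof. by move=> bX; apply: le_normr_Rintegral => //; exact: bounded_rv_integrable. Qed.

Lemma Ex_indic A : measurable A -> Ex \1_A = fine (Pr A).
Proof. by move=> mA; rewrite /Ex /Rintegral integral_indic// setIT. Qed.

Lemma Ex_restrict A X : measurable A ->
  \int[Pr]_(w in A) X w = Ex (fun w => X w * \1_A w).
Proof.
move=> mA; rewrite Rintegral_mkcond; apply: eq_Rintegral => w _.
by rewrite patchE indicE; case: ifP; rewrite ?mulr1 ?mulr0.
Qed.

Lemma Ex_ae X Y : bounded_rv X -> bounded_rv Y -> {ae Pr, forall w, X w = Y w} -> Ex X = Ex Y.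
Proof.
move=> bX bY XY; congr fine; apply: ae_eq_integral => //.
- exact/measurable_EFinP/bX.1.
- exact/measurable_EFinP/bY.1.
- by apply: filterS XY => w /= -> .
Qed.

(** The conclusion includes that the limit is again a bounded random variable; the measurability of
    [limit_state] is obtained this way. *)
Lemma Ex_dominated_cvg (X_ : nat -> T -> R) X M :
  (forall t, measurable_fun setT (X_ t)) -> (forall t w, `|X_ t w| <= M) ->
  (forall w, X_ t w @[t --> \oo] --> X w) ->
  bounded_rv X /\ Ex (X_ t) @[t --> \oo] --> Ex X.
Proof.
move=> mX XM Xcvg.
have mlim : measurable_fun setT X.
  by apply: (measurable_fun_cvg (h := X_)) => // w _; exact: Xcvg.
have bX : bounded_rv X.
  split => //; exists M => w.
  apply: (@closed_cvg _ _ _ _ _ (fun r : R => r <= M)) (cvg_norm (Xcvg w)).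
    exact: closed_le.
  by apply: nearW => t /=; exact: XM.
split=> //.
have bXt t : bounded_rv (X_ t) by split => //; exists M.
have cX : {ae Pr, forall w, [set: T] w -> (EFin \o X_ t) w @[t --> \oo] --> (EFin \o X) w}.
  by apply: aeW => w _; apply: cvg_EFin (Xcvg w); exact: nearW.
have dX : {ae Pr, forall w t, [set: T] w -> (`|(EFin \o X_ t) w| <= (EFin \o cst M) w)%E}.
  by apply: aeW => w t _; rewrite /= lee_fin.
have iM : Pr.-integrable [set: T] (EFin \o cst M) by exact: finite_measure_integrable_cst.
have mE t : measurable_fun setT (EFin \o X_ t) by exact/measurable_EFinP.
have mEX : measurable_fun setT (EFin \o X) by exact/measurable_EFinP.
have [_ _ h] := dominated_convergence measurableT mE mEX cX iM dX.
rewrite /Ex /Rintegral; apply: fine_cvg; rewrite -/(Rintegral Pr setT X) fineK //.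
by apply: integrable_fin_num => //; exact: bounded_rv_integrable.
Qed.
End BoundedRandomVariables.

(** * Orthogonality to a family of events, and independence *)

Definition measurable_wrt (T : Type) (R : realType) (G : set (set T)) (Z : T -> R) :=
  forall B : set R, measurable B -> G (Z @^-1` B).

Section Orthogonality.
Context d (T : measurableType d) (R : realType) (Pr : probability T R).
Implicit Types (X Y Z W : T -> R).

(* With [u : T -> [0, 1]] an affine image of [Z], the sum of the indicators of
   [u >= j / N] over [1 <= j <= N] is within 1 of [N * u], so that [N * |E(W u)|]
   stays bounded as [N] grows. *)
Lemma Ex_orthogonal (G : set (set T)) W Z :
  bounded_rv W -> bounded_rv Z -> measurable_wrt G Z ->
  (forall A, G A -> Ex Pr (fun w => W w * \1_A w) = 0) ->
  Ex Pr (fun w => W w * Z w) = 0.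
Proof.
move=> bW bZ GZ WG; have [_ [C WC]] := bW; have [mZ [M0 ZM0]] := bZ.
(* The added 1 keeps the divisor [2 * M] positive even if [Z] vanishes. *)
pose M : R := `|M0| + 1; have M_gt0 : 0 < M by rewrite ltr_wpDl.
have ZM w : `|Z w| <= M by rewrite (le_trans (ZM0 w))// (le_trans (ler_norm _))// lerDl.
pose u w := (Z w + M) / (2 * M).
have u01 w : 0 <= u w <= 1.
  have := ZM w; rewrite ler_norml /u => /andP[? ?].
  by rewrite divr_ge0 ?ler_pdivrMr/=; nra.
have bu : bounded_rv u.
  rewrite (_ : u = fun w => (2 * M)^-1 * (Z w + M)); last by apply/funext => w; rewrite /u mulrC.
  by apply: bounded_rvZ; apply: bounded_rvD => //; exact: bounded_rv_cst.
have NE N : N%:R * `|Ex Pr (fun w => W w * u w)| <= C.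
  pose A (j : 'I_N) := Z @^-1` `[2 * M * j.+1%:R / N%:R - M, +oo[%classic.
  have mA j : measurable (A j) by rewrite -[A j]setTI; exact: mZ.
  have GA j : G (A j) by exact: GZ.
  pose S w : R := \sum_(j < N) \1_(A j) w.
  have bS : bounded_rv S by apply: bounded_rv_sum => j _; exact: bounded_rv_indic.
  (* The number of [j < N] with [j + 1 <= N u] is the integer part of [N u]. *)
  have SE w : S w = (Num.truncn (N%:R * u w))%:R.
    have Nu0 : 0 <= N%:R * u w by rewrite mulr_ge0//; case/andP: (u01 w).
    have NuN : (Num.truncn (N%:R * u w) <= N)%N.
      by rewrite truncn_le_nat -natr1 ltr_pwDr// ler_piMr//; case/andP: (u01 w).
    rewrite /S -[in RHS](card_ord (Num.truncn _)) -sum1_card natr_sum.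
    rewrite (big_ord_widen _ (fun=> 1) NuN) [RHS]big_mkcond/=.
    apply: eq_bigr => j _; rewrite indicE truncn_gt_nat /A.
    have N0 : 0 < N%:R :> R by rewrite ltr0n (leq_ltn_trans _ (ltn_ord j)).
    have -> : (w \in Z @^-1` `[2 * M * j.+1%:R / N%:R - M, +oo[%classic) = (j.+1%:R <= N%:R * u w).
      apply/idP/idP; rewrite inE/= in_itv/= andbT /u lerBlDr ler_pdivrMr//;
      rewrite mulrA ler_pdivlMr ?mulr_gt0//;
      by rewrite ![_ * N%:R]mulrC [j.+1%:R * _]mulrC.
    by case: (j.+1%:R <= _).
  have dif w : `|N%:R * u w - S w| <= 1.
    rewrite SE; have /truncn_itv/andP[h1 h2] : 0 <= N%:R * u w.
      by rewrite mulr_ge0//; case/andP: (u01 w).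
    by rewrite ger0_norm ?subr_ge0// lerBlDl natr1 ltW.
  have WS : Ex Pr (fun w => W w * S w) = 0.
    rewrite (_ : (fun w => _) = fun w => \sum_(j < N) W w * \1_(A j) w); last first.
      by apply/funext => w; rewrite mulr_sumr.
    rewrite Ex_sum; last by move=> j _; apply: bounded_rvM => //; exact: bounded_rv_indic.
    by rewrite big1// => j _; exact: WG.
  have bWu : bounded_rv (fun w => W w * u w) by exact: bounded_rvM.
  have bWS : bounded_rv (fun w => W w * S w) by exact: bounded_rvM.
  rewrite -[N%:R]ger0_norm// -normrM -ExZ// -[Ex _ _]subr0 -WS -ExB//; last exact: bounded_rvZ.
  have bD : bounded_rv (fun w => N%:R * (W w * u w) - W w * S w).
    by apply: bounded_rvB => //; exact: bounded_rvZ.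
  apply: le_trans (Ex_norm _ bD) _.
  rewrite -[leRHS](Ex_cst Pr C); apply: Ex_le; [exact: bounded_rv_norm|exact: bounded_rv_cst|] => w.
  rewrite mulrCA -mulrBr normrM -[leRHS]mulr1 ler_pM//.
have Wu0 : Ex Pr (fun w => W w * u w) = 0.
  apply/eqP; rewrite -normr_eq0; apply/negPn/negP => e0.
  have {}e0 : 0 < `|Ex Pr (fun w => W w * u w)| by rewrite lt_neqAle eq_sym e0/=.
  have := NE (Num.truncn (C / `|Ex Pr (fun w => W w * u w)|)).+1.
  rewrite leNgt => /negP; apply; rewrite -ltr_pdivrMr//.
  exact: truncnS_gt.
(* [G] is an arbitrary set system; it contains the whole space as a preimage under [Z]. *)
have GT : G setT by rewrite -(preimage_setT Z); exact: GZ.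
have W0 : Ex Pr W = 0.
  by rewrite -[RHS](WG _ GT); congr Ex; apply/funext => w; rewrite indicT mulr1.
rewrite (_ : (fun w => _) = fun w => (2 * M) * (W w * u w) - M * W w); last first.
  by apply/funext => w; rewrite /u; field; rewrite gt_eqF.
rewrite ExB; [|by apply: bounded_rvZ; exact: bounded_rvM|exact: bounded_rvZ].
by rewrite !ExZ ?Wu0 ?W0; [ring| |exact: bounded_rvM].
Qed.

(** Two uses of orthogonality. For [A] in [G], independence makes the centered indicator of [A]
    orthogonal to the events of [F], hence to [X]. Read the other way, the centered [X] is
    orthogonal to the events of [G], hence to [Y]. *)
Lemma Ex_independent (F G : set (set T)) X Y :
  F `<=` measurable -> G `<=` measurable -> independent_pair Pr F G ->
  bounded_rv X -> bounded_rv Y -> measurable_wrt F X -> measurable_wrt G Y ->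
  Ex Pr (fun w => X w * Y w) = Ex Pr X * Ex Pr Y.
Proof.
move=> Fm Gm FG bX bY FX GY.
have XA A : G A -> Ex Pr (fun w => X w * \1_A w) = Ex Pr X * Ex Pr \1_A.
  move=> GA; have bA := @bounded_rv_indic _ _ R _ (Gm _ GA).
  apply/eqP; rewrite -subr_eq0 -[Ex Pr X * _]mulrC -ExZ//.
  rewrite -ExB; [|exact: bounded_rvM|exact: bounded_rvZ].
  under eq_fun do rewrite [X _ * _]mulrC -mulrBl.
  apply/eqP; apply: (@Ex_orthogonal F) => //.
    by apply: bounded_rvB => //; exact: bounded_rv_cst.
  move=> B FB; have bB := @bounded_rv_indic _ _ R _ (Fm _ FB).
  under eq_fun do rewrite mulrBl.
  rewrite ExB; [|exact: bounded_rvM|exact: bounded_rvZ].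
  rewrite ExZ// (_ : (fun w => _) = \1_(B `&` A)); last first.
    by apply/funext => w; rewrite indicI mulrC.
  rewrite !Ex_indic; [|exact: Fm|exact: Gm|by apply: measurableI; [exact: Fm|exact: Gm]].
  rewrite FG// fineM ?fin_num_measure//; [ring|exact: Fm|exact: Gm].
apply/eqP; rewrite -subr_eq0 -ExZ// -ExB; [|exact: bounded_rvM|exact: bounded_rvZ].
under eq_fun do rewrite -mulrBl.
apply/eqP; apply: (@Ex_orthogonal G) => //.
  by apply: bounded_rvB => //; exact: bounded_rv_cst.
move=> A GA; have bA := @bounded_rv_indic _ _ R _ (Gm _ GA).
under eq_fun do rewrite mulrBl.
rewrite ExB; [|exact: bounded_rvM|exact: bounded_rvZ].
by rewrite XA// ExZ// subrr.
Qed.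
End Orthogonality.
(** * A strong law of large numbers *)

Section StrongLaw.
Context (R : realType).

Lemma square_bracket t : exists k, (k ^ 2 <= t < k.+1 ^ 2)%N.
Proof.
elim: t => [|t [k /andP[k1 k2]]]; first by exists 0%N.
have [h|h] := ltnP t.+1 (k.+1 ^ 2); first by exists k; rewrite h ltnW.
exists k.+1; rewrite h/=; apply: leq_ltn_trans k2 _.
by rewrite ltn_exp2r.
Qed.

Lemma series_inv_square n : \sum_(k < n) (k.+1%:R ^- 2 : R) <= 2.
Proof.
(* The strengthened bound is inductive: the new term is at most the difference
   [2 / (n + 1) - 2 / (n + 2)]. *)
suff : \sum_(k < n) (k.+1%:R ^- 2 : R) <= 2 - 2 / n.+1%:R.
  by move/le_trans; apply; rewrite gerBl divr_ge0.
elim: n => [|n IH]; first by rewrite big_ord0 divr1 subrr.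
rewrite big_ord_recr/= (le_trans (lerD IH (lexx _)))//.
set a : R := n.+1%:R; have a1 : 1 <= a by rewrite ler1n.
rewrite -[n.+2%:R]natr1 -/a.
suff : 2 / (a + 1) <= 2 / a - a ^- 2.
  by move: (2 / (a + 1)) (2 / a) (a ^- 2) => p q r; lra.
have -> : 2 / a - a ^- 2 = (2 * a - 1) / a ^+ 2.
  by field; rewrite gt_eqF//; lra.
rewrite ler_pdivrMr; last by lra.
rewrite mulrAC ler_pdivlMr; last by rewrite exprn_gt0//; lra.
by rewrite expr2; nra.
Qed.

(** Between two consecutive squares [s] makes a number of steps of the order of the square root of
    [t], each of size at most [C], which is negligible after division by [t]. *)
Lemma cvg_average_of_squares (s : nat -> R) (C : R) :
  (forall t, `|s t.+1 - s t| <= C) ->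
  s (k.+1 ^ 2)%N / (k.+1 ^ 2)%:R @[k --> \oo] --> 0 ->
  t%:R^-1 * s t @[t --> \oo] --> 0.
Proof.
move=> sC /cvgrPdist_lt sk; apply/cvgrPdist_lt => e e0.
have C0 : 0 <= C by exact: le_trans (sC 0%N).
have sCn t n : `|s (t + n)%N - s t| <= C * n%:R.
  elim: n => [|n IH]; first by rewrite addn0 subrr normr0 mulr0.
  have -> : s (t + n.+1)%N - s t = (s (t + n).+1 - s (t + n)%N) + (s (t + n)%N - s t).
    by rewrite addnS; ring.
  rewrite (le_trans (ler_normD _ _))// -natr1 mulrDr mulr1 addrC lerD//.
have e2 : 0 < e / 2 by rewrite divr_gt0.
have [K1 _ HK1] := sk _ e2.
(* The drift after the square of [k + 1] is at most [C * (2 (k + 1) + 1)], hence at most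
   [3 C (k + 1)]. *)
pose K2 := (Num.truncn (3 * C / (e / 2))).+1.
have HK2 k : (K2 <= k)%N -> 3 * C / k.+1%:R < e / 2.
  move=> kK; rewrite ltr_pdivrMr// [ltRHS]mulrC -ltr_pdivrMr//.
  by apply: (lt_le_trans (truncnS_gt _)); rewrite ler_nat (leq_trans kK).
exists ((maxn K1 K2).+2 ^ 2)%N => // t /= tK.
have [[|k] /andP[k1 k2]] := square_bracket t.
  by have := leq_ltn_trans tK k2; rewrite ltn_exp2r.
have kK : (maxn K1 K2 <= k)%N.
  by have := leq_ltn_trans tK k2; rewrite ltn_exp2r// !ltnS => /ltnW.
have /HK1/= : (K1 <= k)%N by rewrite (leq_trans _ kK)// leq_maxl.
have /HK2 : (K2 <= k)%N by rewrite (leq_trans _ kK)// leq_maxr.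
rewrite !sub0r !normrN normrM normfV => h2 h1.
have q0 : 0 < (k.+1 ^ 2)%:R :> R by rewrite ltr0n expn_gt0.
have t0 : 0 < t%:R :> R by rewrite ltr0n (leq_trans _ k1)// expn_gt0.
rewrite normrM normfV [`|t%:R|]ger0_norm ?ler0n// mulrC ltr_pdivrMr//.
have : `|s t| <= `|s (k.+1 ^ 2)%N| + C * (2 * k.+1%:R + 1).
  have -> : s t = s (k.+1 ^ 2)%N + (s (k.+1 ^ 2 + (t - k.+1 ^ 2))%N - s (k.+1 ^ 2)%N).
    by rewrite subnKC//; ring.
  rewrite (le_trans (ler_normD _ _))// lerD2l (le_trans (sCn _ _))// ler_wpM2l//.
  rewrite -(ler_nat R) in k2; rewrite natrB//.
  move: k2; rewrite !natrX -[k.+2%:R]natr1 -[t.+1%:R]natr1; nra.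
move=> st; apply: le_lt_trans st _.
have h1' : `|s (k.+1 ^ 2)%N| < e / 2 * (k.+1 ^ 2)%:R.
  by rewrite -ltr_pdivrMr// -[X in _ / X]ger0_norm.
have h2' : 3 * C * k.+1%:R <= e / 2 * (k.+1 ^ 2)%:R.
  rewrite natrX expr2 mulrA ler_pM2r ?ltr0n//.
  by move: h2; rewrite ltr_pdivrMr ?ltr0n// => /ltW.
have h3 : (k.+1 ^ 2)%:R <= t%:R :> R by rewrite ler_nat.
have h4 : 1 <= k.+1%:R :> R by rewrite ler1n.
have h5 : C <= C * k.+1%:R by rewrite ler_peMr.
have h6 : e * (k.+1 ^ 2)%:R <= e * t%:R by rewrite ler_pM2l.
lra.
Qed.

Context d (T : measurableType d) (Pr : probability T R).

(* The second moment of [S_t / t] is at most [C ^ 2 / t]: it is summable along the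
   squares, and a bounded sequence moves little between two squares. *)
Lemma strong_law_uncorrelated (X : nat -> T -> R) (C : R) :
  (forall k, measurable_fun setT (X k)) -> (forall k w, `|X k w| <= C) ->
  (forall k l, (k < l)%N -> Ex Pr (fun w => X k w * X l w) = 0) ->
  {ae Pr, forall w, t%:R^-1 * (\sum_(l < t) X l w) @[t --> \oo] --> 0}.
Proof.
move=> mX XC X0.
have C0 : 0 <= C by exact: le_trans (XC 0%N point).
have bX k : bounded_rv (X k) by split => //; exists C.
pose S t w : R := \sum_(l < t) X l w.
have bS t : bounded_rv (S t) by apply: bounded_rv_sum => l _.
have ES t : Ex Pr (fun w => S t w ^+ 2) <= C ^+ 2 * t%:R.
  elim: t => [|t IH].
    under eq_fun do rewrite /S big_ord0 expr0n/=.
    by rewrite Ex_cst mulr0.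
  have -> : (fun w => S t.+1 w ^+ 2) =
    fun w => S t w ^+ 2 + (2 * (\sum_(l < t) X l w * X t w) + X t w ^+ 2).
    by apply/funext => w; rewrite /S big_ord_recr/= -mulr_suml -/(S t w); ring.
  have bXX l : bounded_rv (fun w => X l w * X t w) by exact: bounded_rvM.
  rewrite ExD; [|exact: bounded_rvM|]; last first.
    apply: bounded_rvD; last exact: bounded_rvM.
    by apply: bounded_rvZ; exact: bounded_rv_sum.
  rewrite ExD; [| |exact: bounded_rvM]; last first.
    by apply: bounded_rvZ; exact: bounded_rv_sum.
  rewrite ExZ; last exact: bounded_rv_sum.
  rewrite Ex_sum// big1; last by move=> l _; exact: X0.
  rewrite mulr0 add0r -natr1 mulrDr mulr1 lerD//.
  rewrite -[leRHS](Ex_cst Pr); apply: Ex_le; [exact: bounded_rvM|exact: bounded_rv_cst|] => w.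
  by rewrite -real_normK ?num_real// lerXn2r ?nnegrE.
(* The index [k.+1] avoids a division by 0. The mean of [f k] is at most [C ^ 2 / (k + 1) ^ 2], a
   summable bound. *)
pose f k w := (S (k.+1 ^ 2)%N w / (k.+1 ^ 2)%:R) ^+ 2.
have bf k : bounded_rv (f k).
  rewrite (_ : f k = fun w => (k.+1 ^ 2)%:R ^- 2 * (S (k.+1 ^ 2)%N w * S (k.+1 ^ 2)%N w)).
    by apply: bounded_rvZ; exact: bounded_rvM.
  by apply/funext => w; rewrite /f expr_div_n mulrC expr2.
have f0 k w : 0 <= f k w by exact: sqr_ge0.
have Ef k : Ex Pr (f k) <= C ^+ 2 * k.+1%:R ^- 2.
  rewrite (_ : f k = fun w => (k.+1 ^ 2)%:R ^- 2 * (S (k.+1 ^ 2)%N w ^+ 2)).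
    rewrite ExZ; last exact: bounded_rvM.
    have q0 : 0 < (k.+1 ^ 2)%:R :> R by rewrite ltr0n expn_gt0.
    rewrite mulrC ler_pdivrMr ?exprn_gt0//; apply: le_trans (ES _) _.
    have : k.+1%:R != 0 :> R by rewrite pnatr_eq0.
    rewrite natrX; move: (k.+1%:R : R) => a a0.
    by rewrite le_eqVlt; apply/orP; left; apply/eqP; field.
  by apply/funext => w; rewrite /f expr_div_n mulrC.
have Esum : (\int[Pr]_w (\sum_(0 <= k <oo) (f k w)%:E) < +oo)%E.
  rewrite integral_nneseries//; first last.
  - by move=> k w _; rewrite lee_fin.
  - by move=> k; apply/measurable_EFinP; exact: (bf k).1.
  apply: (@le_lt_trans _ _ (C ^+ 2 * 2)%:E); last by rewrite ltry.
  apply: lime_le.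
    apply: is_cvg_nneseries => k _ _; apply: integral_ge0 => w _; rewrite lee_fin//.
  apply: nearW => n; under eq_bigr do rewrite ExE//.
  rewrite sumEFin lee_fin big_mkord.
  apply: (@le_trans _ _ (\sum_(k < n) C ^+ 2 * k.+1%:R ^- 2)); first exact: ler_sum.
  by rewrite -mulr_sumr ler_wpM2l ?series_inv_square// sqr_ge0.
have mser : measurable_fun setT (fun w => (\sum_(0 <= k <oo) (f k w)%:E)%E).
  apply: ge0_emeasurable_sum => // k; first by move=> w _ _; rewrite lee_fin.
  by move=> _; apply/measurable_EFinP; exact: (bf k).1.
have iser : Pr.-integrable setT (fun w => (\sum_(0 <= k <oo) (f k w)%:E)%E).
  apply/integrableP; split => //.
  rewrite (eq_integral (fun w => \sum_(0 <= k <oo) (f k w)%:E)%E)// => w _.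
  by rewrite gee0_abs// nneseries_ge0// => k _ _; rewrite lee_fin.
(* A series of nonnegative variables with finite mean is finite almost surely, so its terms tend to
   0. *)
apply: filterS (integrable_ae measurableT iser) => w /(_ I) fin.
apply: (@cvg_average_of_squares (fun t => S t w) C).
  by move=> t; rewrite /S big_ord_recr/= addrAC subrr add0r.
have cf : series (fun k => f k w) n @[n --> \oo] --> fine (\sum_(0 <= k <oo) (f k w)%:E)%E.
  have h : (series (fun k => f k w) n)%:E @[n --> \oo] -->
      (fine (\sum_(0 <= k <oo) (f k w)%:E)%E)%:E.
    rewrite fineK//.
    have : cvgn (fun n => \sum_(0 <= k < n) (f k w)%:E)%E.
      by apply: is_cvg_nneseries => k _ _; rewrite lee_fin.
    by under eq_fun do rewrite sumEFin; exact.
  exact: fine_cvg h.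
have f00 : f k w @[k --> \oo] --> 0.
  by apply: cvg_series_cvg_0; apply/cvg_ex; eexists; exact: cf.
have := cvg_comp _ _ f00 (@sqrt_continuous R 0).
rewrite sqrtr0 (_ : _ \o _ = fun k => `|S (k.+1 ^ 2)%N w / (k.+1 ^ 2)%:R|); last first.
  by apply/funext => k; rewrite /= /f sqrtr_sqr.
by move/norm_cvg0P.
Qed.
End StrongLaw.
(** * Sub-sigma-algebras and matrices *)

Section MeasurableWrt.
Context (T : pointedType) (R : realType).
Implicit Types (G : set (set T)) (X Y Z : T -> R).

Lemma measurable_wrtS F G X : F `<=` G -> measurable_wrt F X -> measurable_wrt G X.
Proof. by move=> FG FX B mB; apply/FG/FX. Qed.

Lemma measurable_wrtP G X :
  measurable_wrt <<s G >> X <-> measurable_fun setT (X : g_sigma_algebraType G -> R).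
Proof.
split=> [GX _ B mB|mX B mB]; first by rewrite setTI; exact: GX.
by have := mX measurableT B mB; rewrite setTI.
Qed.

Lemma measurable_wrt_cst G c : measurable_wrt <<s G >> (fun=> c : R).
Proof. exact/measurable_wrtP/measurable_cst. Qed.

Lemma measurable_wrtD G X Y : measurable_wrt <<s G >> X -> measurable_wrt <<s G >> Y ->
  measurable_wrt <<s G >> (fun w => X w + Y w).
Proof.
by move=> /measurable_wrtP ? /measurable_wrtP ?; apply/measurable_wrtP; exact: measurable_funD.
Qed.

Lemma measurable_wrtM G X Y : measurable_wrt <<s G >> X -> measurable_wrt <<s G >> Y ->
  measurable_wrt <<s G >> (fun w => X w * Y w).
Proof.
by move=> /measurable_wrtP ? /measurable_wrtP ?; apply/measurable_wrtP; exact: measurable_funM.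
Qed.

Lemma measurable_wrtZ G c X : measurable_wrt <<s G >> X ->
  measurable_wrt <<s G >> (fun w => c * X w).
Proof. by apply: measurable_wrtM; exact: measurable_wrt_cst. Qed.

Lemma measurable_wrtB G X Y : measurable_wrt <<s G >> X -> measurable_wrt <<s G >> Y ->
  measurable_wrt <<s G >> (fun w => X w - Y w).
Proof.
by move=> /measurable_wrtP ? /measurable_wrtP ?; apply/measurable_wrtP; exact: measurable_funB.
Qed.

Lemma measurable_wrt_sum G (I : Type) (r : seq I) (F : I -> T -> R) :
  (forall i, measurable_wrt <<s G >> (F i)) ->
  measurable_wrt <<s G >> (fun w => \sum_(i <- r) F i w).
Proof.
move=> FG; elim: r => [|i r IH].
  by under eq_fun do rewrite big_nil; exact: measurable_wrt_cst.
by under eq_fun do rewrite big_cons; exact: measurable_wrtD.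
Qed.

Lemma measurable_wrt_indic G A : <<s G >> A -> measurable_wrt <<s G >> (\1_A : T -> R).
Proof.
move=> GA; apply/measurable_wrtP.
exact: (@measurable_indic _ (g_sigma_algebraType G) R setT A).
Qed.

End MeasurableWrt.

Section MatrixSigma.
Context (R : realType).

Lemma sigma_mx_entry (T : Type) m n (X : T -> 'M[R]_(m, n)) i j :
  measurable_wrt (sigma_mx X) (fun w => X w i j).
Proof.
move=> B mB; apply: sub_sigma_algebra; exists (i, j) => //=.
by exists B => //; rewrite setTI.
Qed.

Lemma sigma_mx_measurable d (T : measurableType d) m n (X : T -> 'M[R]_(m, n)) :
  random_mx X -> sigma_mx X `<=` measurable.
Proof.
move=> mX; apply: smallest_sub; first exact: sigma_algebra_measurable.
by move=> A [[i j] _ /= [B mB <-]]; exact: mX.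
Qed.

Lemma sigma_mx_preimage (T : Type) m n (X : T -> 'M[R]_(m, n)) A :
  sigma_mx (@id 'M[R]_(m, n)) A -> sigma_mx X (X @^-1` A).
Proof.
move=> idA; suff : sigma_mx (@id 'M[R]_(m, n)) `<=` [set A | sigma_mx X (X @^-1` A)].
  exact.
apply: smallest_sub; last first.
  by move=> _ [[i j] _ /= [B mB <-]] /=; rewrite setTI; exact: sigma_mx_entry.
have [s0 sC sU] := smallest_sigma_algebra setT
  (\bigcup_(ij in [set: 'I_m * 'I_n]) sigma_entry X ij.1 ij.2).
split => /=.
- by rewrite preimage_set0.
- by move=> B XB; rewrite setTD preimage_setC -setTD; exact: sC.
- by move=> F XF; rewrite preimage_bigcup; exact: sU.
Qed.

Lemma sigma_mx_point (T : pointedType) m n (X : T -> 'M[R]_(m, n)) Q :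
  sigma_mx X [set w | X w = Q].
Proof.
set G := \bigcup_(ij in [set: 'I_m * 'I_n]) sigma_entry X ij.1 ij.2.
have -> : [set w | X w = Q] = \bigcap_(i in [set: 'I_m]) \bigcap_(j in [set: 'I_n])
    (fun w => X w i j) @^-1` [set Q i j].
  apply/seteqP; split => w /=; first by move=> XQ i _ j _; rewrite /= XQ.
  by move=> h; apply/matrixP => i j; exact: h.
have fI k (F : 'I_k -> set T) : (forall i, <<s G >> (F i)) ->
    <<s G >> (\bigcap_(i in [set: 'I_k]) F i).
  move=> GF; apply: (@fin_bigcap_measurable _ (g_sigma_algebraType G)) => // i _; exact: GF.
by apply: (fI) => i; apply: (fI) => j; apply: sigma_mx_entry; exact: measurable_set1.
Qed.

(** Uniqueness of finite measures on a pi-system, applied to [Pr] restricted to [E] and to [Pr]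
    scaled by the mass of [E]. *)
Lemma independent_pair_g_sigma d (T : measurableType d) (Pr : probability T R)
    (E : set T) (G : set (set T)) :
  measurable E -> G `<=` measurable -> setI_closed G -> G setT ->
  (forall A, G A -> Pr (E `&` A) = (Pr E * Pr A)%E) ->
  forall A, <<s G >> A -> Pr (E `&` A) = (Pr E * Pr A)%E.
Proof.
move=> mE Gm GI GT EG A GA.
have PE0 : 0 <= fine (Pr E) by rewrite fine_ge0.
pose m1 := mrestr Pr mE : {measure set T -> \bar R}.
pose m2 := mscale (NngNum PE0) Pr : {measure set T -> \bar R}.
have m2E B : m2 B = (Pr E * Pr B)%E.
  by rewrite /m2/= /mscale/= fineK// fin_num_measure.
rewrite -m2E setIC -[LHS]/(m1 A).
apply: (g_sigma_algebra_measure_unique G Gm (fun=> setT)) => //.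
- by rewrite bigcup_const.
- by move=> B GB; rewrite m2E -EG// /m1/= /mrestr setIC.
- by move=> _; rewrite /m1/= /mrestr setTI ltey_eq fin_num_measure.
Qed.

(** [S] has no measurable structure of its own and receives the one generated by the pi-system [G].
    This serves for infinite sequences of inputs, where only finitely many letters are
    constrained. *)
Lemma same_law_g_sigma d (T : measurableType d) (Pr : probability T R) (S : pointedType)
    (G : set (set S)) (X Y : T -> S) (g : S -> R) :
  setI_closed G -> G setT ->
  (forall A, G A -> measurable (X @^-1` A)) ->
  (forall A, G A -> measurable (Y @^-1` A)) ->
  (forall A, G A -> Pr (X @^-1` A) = Pr (Y @^-1` A)) ->
  measurable_wrt <<s G >> g -> bounded_rv (fun w => g (X w)) -> bounded_rv (fun w => g (Y w)) ->
  Ex Pr (fun w => g (X w)) = Ex Pr (fun w => g (Y w)).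
Proof.
move=> GI GT GX GY XY mg bX bY.
pose S' := g_sigma_algebraType G.
have mX : measurable_fun setT (X : T -> S').
  apply: (measurability (G : set (set (g_sigma_algebraType G)))) => // _ [A GA <-].
  by rewrite setTI; exact: GX.
have mY : measurable_fun setT (Y : T -> S').
  apply: (measurability (G : set (set (g_sigma_algebraType G)))) => // _ [A GA <-].
  by rewrite setTI; exact: GY.
pose X' : {mfun T >-> S'} := HB.pack (X : T -> S') (isMeasurableFun.Build _ _ _ _ _ mX).
pose Y' : {mfun T >-> S'} := HB.pack (Y : T -> S') (isMeasurableFun.Build _ _ _ _ _ mY).
have gS : measurable_fun setT (EFin \o g : S' -> \bar R).
  by apply/measurable_EFinP/measurable_wrtP.
have XYE A : measurable (A : set S') -> distribution Pr X' A = distribution Pr Y' A.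
  move=> mA; apply: (@measure_unique _ R S' G (fun=> setT) erefl GI (fun=> GT) _
    (distribution Pr X') (distribution Pr Y') XY _ A mA) => //.
  - by rewrite bigcup_const.
  - by move=> _; rewrite ltey_eq fin_num_measure.
congr fine.
rewrite -[LHS](@integral_distribution _ _ _ _ _ Pr X' _ gS); last exact: bounded_rv_integrable.
rewrite -[RHS](@integral_distribution _ _ _ _ _ Pr Y' _ gS); last exact: bounded_rv_integrable.
by apply: eq_measure_integral => A mA _; exact: XYE.
Qed.
End MatrixSigma.

(** * Convergence, measurability and uniform continuity for column vectors *)

Section MatrixTopology.
Context (R : realType).

Lemma cvg_mx (I : Type) (F : set_system I) {FF : Filter F} m n
    (f : I -> 'M[R]_(m, n)) (L : 'M[R]_(m, n)) :
  (forall i j, f t i j @[t --> F] --> L i j) -> f @ F --> L.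
Proof.
move=> fL A [P LP PA].
suff : \forall t \near F, forall ij : 'I_m * 'I_n, P ij.1 ij.2 (f t ij.1 ij.2).
  by apply: filterS => t ft; apply: PA => i j; exact: (ft (i, j)).
by apply: filter_forall => -[i j]; exact: fL.
Qed.

Lemma cvg_mulmx (I : Type) (F : set_system I) {FF : Filter F} m n (A : 'M[R]_(m, n))
    (z : I -> 'cV[R]_n) (L : 'cV[R]_n) :
  (forall w, z t w 0 @[t --> F] --> L w 0) ->
  forall v, (A *m z t) v 0 @[t --> F] --> (A *m L) v 0.
Proof.
move=> zL v; rewrite mxE; under eq_fun do rewrite mxE.
apply: cvg_big => [|w _]; first exact: add_continuous.
by apply: cvgMr; exact: zL.
Qed.

(* [f \o X] is the pointwise limit of [f] applied to the rounding of [X] to the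
   grid of mesh 1/k, which takes countably many values. *)
Lemma measurable_fun_continuous_mx d (T : measurableType d) n
    (X : T -> 'cV[R]_n) (f : 'cV[R]_n -> R) :
  random_mx X -> continuous f -> measurable_fun setT (f \o X).
Proof.
move=> mX cf.
pose fl (k : nat) w : 'cV[int]_n := \col_v Num.floor (k.+1%:R * X w v 0).
pose rd (k : nat) (z : 'cV[int]_n) : 'cV[R]_n := \col_v (k.+1%:R^-1 * (z v 0)%:~R).
apply: (@measurable_fun_cvg _ _ _ _ (fun k w => f (rd k (fl k w)))); last first.
  move=> w _; apply: continuous_cvg; first exact: cf.
  apply: cvg_mx => v j; rewrite ord1.
  rewrite (_ : (fun k => _) =
      fun k => k.+1%:R^-1 * (Num.floor (k.+1%:R * X w v 0))%:~R); last first.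
    by apply/funext => k; rewrite !mxE.
  apply/cvgrPdist_le => e e0.
  exists (Num.truncn e^-1) => // k /= ke.
  have k0 : 0 < k.+1%:R :> R by [].
  have -> : X w v 0 - k.+1%:R^-1 * (Num.floor (k.+1%:R * X w v 0))%:~R =
    k.+1%:R^-1 * (k.+1%:R * X w v 0 - (Num.floor (k.+1%:R * X w v 0))%:~R).
    by rewrite mulrBr mulKf// gt_eqF.
  have /andP[h1 h2] := mem_rg1_floor (k.+1%:R * X w v 0).
  rewrite ger0_norm; last by rewrite mulr_ge0// subr_ge0.
  rewrite mulrC ler_pdivrMr//; apply: (@le_trans _ _ 1).
    by rewrite lerBlDl ltW.
  by rewrite -ler_pdivrMl// mulr1 (le_trans (ltW (truncnS_gt _)))// ler_nat ltnS.
move=> k _ B mB; rewrite setTI.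
rewrite (_ : _ @^-1` B = \bigcup_(z : 'cV[int]_n)
    (if `[< B (f (rd k z)) >] then [set w | fl k w = z] else set0)); last first.
  apply/seteqP; split => w /=.
    by move=> Bw; exists (fl k w) => //=; rewrite asboolT.
  by move=> [z _]; case: asboolP => //= Bz ->.
apply: countable_bigcupT_measurable => [|z]; first exact: countableP.
case: asboolP => // _.
rewrite (_ : [set w | fl k w = z] = \bigcap_(v in [set: 'I_n])
   (fun w => k.+1%:R * X w v 0) @^-1` [set r | Num.floor r = z v 0]); last first.
  apply/seteqP; split => w /=.
    by move=> <- v _; rewrite /fl mxE.
  by move=> h; apply/matrixP => v j; rewrite ord1 /fl mxE; exact: h.
apply: fin_bigcap_measurable => // v _.
have mkX : measurable_fun setT (fun w => k.+1%:R * X w v 0 : R).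
  by apply: measurable_funM => //; exact: mX.
have := mkX measurableT [set` `[(z v 0)%:~R, (z v 0 + 1)%:~R[ ] (measurable_itv _).
rewrite setTI; congr measurable; apply/seteqP; split => w /=; rewrite in_itv/=.
  by move=> h; apply: floor_def.
by move=> <-; rewrite intrD; exact: mem_rg1_floor.
Qed.

(** Compactness of the box in its near-covering form, with [d] ranging over the right neighbourhoods
    of 0, makes the local continuity radii uniform. Only [x] is confined to the box. *)
Lemma uniform_continuity_unit_box n (f : 'cV[R]_n -> R) (e : R) : continuous f -> 0 < e ->
  exists2 d, 0 < d & forall x y : 'cV[R]_n, unit_box x ->
    (forall v, `|x v 0 - y v 0| < d) -> `|f x - f y| < e.
Proof.
move=> cf e0.
have cK : compact [set x : 'cV[R]_n | unit_box x].
  have -> : [set x : 'cV[R]_n | unit_box x] =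
     trmx @` [set v : 'rV[R]_n | forall i, `[0, 1]%classic (v ord0 i)].
    apply/seteqP; split => x /=.
      by move=> x01; exists x^T; rewrite ?trmxK// => i; rewrite mxE /= in_itv/=; exact: x01.
    by move=> [z z01 <-] v; rewrite mxE; have := z01 v; rewrite /= in_itv.
  apply: continuous_compact; last first.
    by apply: (@rV_compact R n (fun=> `[0, 1]%classic)) => i; exact: segment_compact.
  apply: continuous_subspaceT => x; apply: (@cvg_mx _ _ (nbhs_filter x)) => i j.
  under eq_fun do rewrite mxE; rewrite mxE; exact: coord_continuous.
have e2 : 0 < e / 2 by rewrite divr_gt0.
pose P (d : R) (x : 'cV[R]_n) := forall y : 'cV[R]_n, (forall v, `|x v 0 - y v 0| < d) ->
  `|f x - f y| < e.
have := (compact_near_coveringP _).1 cK R (0^'+) P _.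
case=> [x /= x01|d /= d0 dP].
  have /cvgrPdist_lt/(_ _ e2)/nbhs_ballP[r /= r0 rP] := cf x.
  have r2 : 0 < r / 2 by rewrite divr_gt0.
  have xr (z : 'cV[R]_n) : (forall v, `|x v 0 - z v 0| < r) -> `|f x - f z| < e / 2.
    by move=> h; apply: rP; split => // i j; rewrite ord1; exact: h.
  exists (ball x (r / 2), [set d | d < r / 2]) => /=.
    split; first exact: nbhsx_ballx.
    exact: nbhs_right_lt.
  move=> [z d] /= [[_ zr] dr] y zy.
  have -> : f z - f y = (f x - f y) - (f x - f z) by ring.
  rewrite (le_lt_trans (ler_normB _ _))// (splitr e) ltrD// xr// => v.
    rewrite -(subrKA (z v 0)) (le_lt_trans (ler_normD _ _))// (splitr r) ltrD//.
      exact: zr.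
    exact: lt_trans (zy v) dr.
  by apply: (lt_trans (zr v 0)); rewrite ltr_pdivrMr// ltr_pMr// ltr1n.
exists (d / 2); first by rewrite divr_gt0.
move=> x y x01; have := dP (d / 2); apply => //=.
- by rewrite sub0r normrN gtr0_norm ?divr_gt0// ltr_pdivrMr// ltr_pMr// ltr1n.
- by rewrite divr_gt0.
Qed.
End MatrixTopology.
(** * Bernoulli weights and the mean dynamics *)

Section BernoulliProduct.
Context (R : comNzRingType) (n : nat) (x : 'I_n -> R).

Definition bernoulli_weight (b : 'I_n -> bool) : R := \prod_v (if b v then x v else 1 - x v).

(** Expansion of the product of the sums [x v + (1 - x v)], all equal to 1. *)
Lemma sum_bernoulli_weight : \sum_(b : {ffun 'I_n -> bool}) bernoulli_weight b = 1.
Proof.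
rewrite -(bigA_distr_bigA (fun v j => if j then x v else 1 - x v)).
by rewrite big1// => v _; rewrite big_bool/= addrCA subrr addr0.
Qed.

Lemma sum_bernoulli_weight_coord v :
  \sum_(b : {ffun 'I_n -> bool} | b v) bernoulli_weight b = x v.
Proof.
(* Suppressing the choice [false] at [v] extends the sum to all patterns, so that it factors; the
   factor at [v] is then [x v] and the others are 1. *)
pose F u (j : bool) := if (u == v) && ~~ j then 0 else if j then x u else 1 - x u.
have : \prod_u \sum_j F u j = \sum_(f : {ffun 'I_n -> bool}) \prod_u F u (f u).
  exact: bigA_distr_bigA.
rewrite (bigD1 v)//= [X in _ * X]big1 => [|u uv]; last first.
  by rewrite big_bool/= /F/= (negbTE uv)/= addrCA subrr addr0.
rewrite big_bool/= /F/= eqxx/= addr0 mulr1 => ->.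
rewrite [RHS](bigID (fun b : {ffun 'I_n -> bool} => b v))/=.
rewrite [X in _ + X]big1 ?addr0 => [|b bv]; last first.
  by rewrite (bigD1 v)//= eqxx (negbTE bv)/= mul0r.
apply: eq_bigr => b bv; apply: eq_bigr => u _.
by have [->|//] := eqVneq u v; rewrite bv.
Qed.

End BernoulliProduct.

(** * The substochastic mean matrix: invertibility and decay *)

Section Contraction.
Context (R : realType) (n : nat) (P : 'M[R]_n) (lam : 'rV[R]_n) (alpha : R).
Hypothesis P_stoch : row_stochastic P.
Hypothesis lam01 : forall v, 0 <= lam 0 v <= 1.
Hypothesis alpha01 : 0 <= alpha <= 1.
Hypothesis alpha_nondeg : alpha = 0 -> forall v, lam 0 v < 1.
Hypothesis topology : topology_assumption P lam.

Lemma row_stochastic_sum (Q : 'M[R]_n) v : row_stochastic Q -> \sum_w Q v w = 1.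
Proof.
move=> [_ /matrixP/(_ v 0)]; rewrite !mxE => <-.
by apply: eq_bigr => w _; rewrite !mxE mulr1.
Qed.

Lemma row_stochastic1 : row_stochastic (1%:M : 'M[R]_n).
Proof. by split=> [v w|]; rewrite ?mul1mx// mxE ler0n. Qed.

Lemma row_stochastic_mean_influence : row_stochastic (mean_influence alpha P).
Proof.
have [a0 a1] := andP alpha01; split=> [v w|].
  rewrite /mean_influence !mxE addr_ge0// mulr_ge0 ?subr_ge0//; exact: P_stoch.1.
rewrite /mean_influence mulmxDl -!scalemxAl mul1mx P_stoch.2 -scalerDl.
by rewrite subrK scale1r.
Qed.

Lemma diag_mul_entry (A : 'M[R]_n) (z : 'cV[R]_n) v :
  (diag_mx lam *m A *m z) v 0 = lam 0 v * \sum_w A v w * z w 0.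
Proof. by rewrite -mulmxA mul_diag_mx mxE [X in _ * X]mxE. Qed.

Let M := diag_mx lam *m mean_influence alpha P.

(* Maximum principle: the set where [|z|] is maximal is closed under the edges of
   the graph, hence contains a node with [lam < 1], where [|z|] cannot be maximal
   unless it vanishes. *)
Lemma fixed_point_eq0 (z : 'cV[R]_n) : M *m z = z -> z = 0.
Proof.
move=> Mz.
have Pbar := row_stochastic_mean_influence.
have Psum v := row_stochastic_sum v Pbar.
have zE v : z v 0 = lam 0 v * \sum_w mean_influence alpha P v w * z w 0.
  by rewrite -diag_mul_entry -/M Mz.
apply/matrixP => v1 j; rewrite ord1 mxE.
pose v0 := [arg max_(v > v1) `|z v 0|]%O.
have zv0 v : `|z v 0| <= `|z v0 0|.
  by rewrite /v0; case: arg_maxP => // i _; exact.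
set m := `|z v0 0| in zv0.
have [m0|m0] := eqVneq m 0.
  by apply/eqP; rewrite -normr_le0 -m0.
have {}m0 : 0 < m by rewrite lt_neqAle eq_sym m0 /m/=.
have bnd v : `|z v 0| <= lam 0 v * \sum_w mean_influence alpha P v w * `|z w 0|.
  rewrite zE normrM ger0_norm; last by case/andP: (lam01 v).
  rewrite ler_wpM2l//; first by case/andP: (lam01 v).
  rewrite (le_trans (ler_norm_sum _ _ _))// ler_sum// => w _.
  by rewrite normrM ger0_norm//; exact: Pbar.1.
have sum_le v : \sum_w mean_influence alpha P v w * `|z w 0| <= m.
  rewrite -[m]mul1r -(Psum v) mulr_suml ler_sum// => w _.
  by rewrite ler_wpM2l//; exact: Pbar.1.
have lam1 v : `|z v 0| = m -> ~ lam 0 v < 1.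
  move=> zvm lv; have := bnd v; rewrite zvm leNgt => /negP; apply.
  apply: (@le_lt_trans _ _ (lam 0 v * m)).
    by rewrite ler_wpM2l//; case/andP: (lam01 v).
  by rewrite gtr_pMl.
have [a0|a0] := eqVneq alpha 0.
  by have := lam1 v0 erefl (alpha_nondeg a0 v0).
have {}a0 : 0 < alpha by rewrite lt_neqAle eq_sym a0/=; case/andP: alpha01.
have step v w : `|z v 0| = m -> 0 < P v w -> `|z w 0| = m.
  move=> zvm Pvw.
  (* At a maximal node the weighted mean of the nonnegative gaps [m - |z w|] vanishes, so each gap
     of positive weight does; an edge of [P] has positive weight because [alpha > 0]. *)
  have : \sum_w mean_influence alpha P v w * (m - `|z w 0|) = 0.
    apply/eqP; rewrite eq_le; apply/andP; split; last first.
      by apply: sumr_ge0 => u _; rewrite mulr_ge0 ?subr_ge0//; exact: Pbar.1.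
    under eq_bigr do rewrite mulrBr; rewrite sumrB -mulr_suml Psum mul1r subr_le0.
    rewrite -{1}zvm (le_trans (bnd v))// ler_piMl//; last by case/andP: (lam01 v).
    by apply: sumr_ge0 => u _; rewrite mulr_ge0//; exact: Pbar.1.
  have nn u : 0 <= mean_influence alpha P v u * (m - `|z u 0|).
    by rewrite mulr_ge0 ?subr_ge0//; exact: Pbar.1.
  move=> /(psumr_eq0P (fun u _ => nn u))/(_ w isT)/eqP; rewrite mulf_eq0 subr_eq0 => /orP[|/eqP//].
  rewrite gt_eqF// /mean_influence !mxE ltr_wpDl ?mulr_gt0//.
  by rewrite mulr_ge0 ?ler0n// subr_ge0; case/andP: alpha01.
have [s /connectP[p pth ->] ls] := topology v0.
exfalso; suff : `|z (last v0 p) 0| = m by move/lam1.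
have : `|z v0 0| = m by [].
elim: p (v0) pth {ls} => //= a p IH v /andP[va pa] zvm.
exact: IH pa (step _ _ zvm va).
Qed.

(** The kernel of [1 - M] consists of the fixed points of [M]. The transposition is due to
    [row_free], which speaks of the left kernel. *)
Lemma unitmx_resolvent : 1%:M - M \in unitmx.
Proof.
rewrite -unitmx_tr -row_free_unit; apply: inj_row_free => v vM.
apply: trmx_inj; rewrite trmx0; apply: fixed_point_eq0.
move/(congr1 trmx): vM; rewrite trmx_mul trmxK trmx0 mulmxBl mul1mx => /eqP.
by rewrite subr_eq0 => /eqP.
Qed.

(** [M] need not contract in one step, since rows with [lam = 1] may keep their full mass. Instead,
    its iterates on the all-one vector decrease because [M] is substochastic; their limit is a fixed
    point, hence 0, and they dominate [u]. *)
Lemma contraction_cvg0 (u : nat -> 'cV[R]_n) :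
  unit_box (u 0%N) -> (forall t, u t.+1 = M *m u t) ->
  forall v, u t v 0 @[t --> \oo] --> 0.
Proof.
move=> u0 uS.
pose c t : 'cV[R]_n := iter t (mulmx M) (const_mx 1).
have ME (z : 'cV[R]_n) v : (M *m z) v 0 = \sum_w M v w * z w 0 by rewrite mxE.
have M0 v w : 0 <= M v w.
  rewrite /M mul_diag_mx mxE mulr_ge0//; first by case/andP: (lam01 v).
  exact: row_stochastic_mean_influence.1.
have mono (z1 z2 : 'cV[R]_n) : (forall v, z1 v 0 <= z2 v 0) ->
    forall v, (M *m z1) v 0 <= (M *m z2) v 0.
  by move=> z12 v; rewrite !ME ler_sum// => w _; rewrite ler_wpM2l.
have cE t : c t.+1 = M *m c t by [].
have c01 v : c 0%N v 0 = 1 by rewrite /c/= mxE.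
have c0 t v : 0 <= c t v 0.
  elim: t v => [|t IH] v; first by rewrite c01.
  by rewrite cE ME sumr_ge0// => w _; rewrite mulr_ge0.
have cS t v : c t.+1 v 0 <= c t v 0.
  elim: t v => [|t IH] v; last by rewrite 2!cE; exact: mono.
  rewrite cE diag_mul_entry c01.
  under eq_bigr do rewrite c01 mulr1.
  by rewrite row_stochastic_sum ?mulr1; [case/andP: (lam01 v)|exact: row_stochastic_mean_influence].
have uc t : (forall v, 0 <= u t v 0) /\ (forall v, u t v 0 <= c t v 0).
  elim: t => [|t [IH0 IH1]].
    by split=> v; have /andP[? ?] := u0 v; rewrite ?c01.
  rewrite uS; split=> v; last by rewrite cE; exact: mono.
  by rewrite ME sumr_ge0// => w _; rewrite mulr_ge0.
have cc v : c t v 0 @[t --> \oo] --> inf (range (fun t => c t v 0)).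
  apply: nonincreasing_cvgn; first by apply/nonincreasing_seqP => t.
  by exists 0 => _ [t _ <-].
pose cl : 'cV[R]_n := \col_v inf (range (fun t => c t v 0)).
have clE v : c t v 0 @[t --> \oo] --> cl v 0 by rewrite mxE.
have cl0 : cl = 0.
  apply: fixed_point_eq0; apply/matrixP => v j; rewrite ord1.
  have h1 : c t.+1 v 0 @[t --> \oo] --> cl v 0.
    by have := clE v; rewrite -(cvg_shiftS (fun t => c t v 0)).
  have h2 : c t.+1 v 0 @[t --> \oo] --> (M *m cl) v 0.
    by under eq_fun do rewrite cE; exact: cvg_mulmx clE v.
  exact: cvg_unique h2 h1.
move=> v; apply: (squeeze_cvgr (f := fun=> 0) (h := fun t => c t v 0)).
- by apply: nearW => t; rewrite (uc t).1 (uc t).2.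
- exact: cvg_cst.
- by have := clE v; rewrite cl0 mxE.
Qed.
End Contraction.
(** * Random influence matrices *)

Section SigmaAlgebraClosure.
Context (T : pointedType).
Implicit Types G : set (set T).

Lemma g_sigmaT G : <<s G >> setT.
Proof. exact: (@measurableT _ (g_sigma_algebraType G)). Qed.

Lemma g_sigmaI G A B : <<s G >> A -> <<s G >> B -> <<s G >> (A `&` B).
Proof. exact: (@measurableI _ (g_sigma_algebraType G)). Qed.

Lemma g_sigma_bigI G (I : eqType) (r : seq I) (E : I -> set T) :
  (forall i, i \in r -> <<s G >> (E i)) -> <<s G >> (\big[setI/setT]_(i <- r) E i).
Proof.
move=> GE; rewrite big_seq; apply: big_ind => //; first exact: g_sigmaT.
by move=> A B; exact: g_sigmaI.
Qed.

Lemma sigma_proc_sub (R : realType) m n (D : set nat) (X : nat -> T -> 'M[R]_(m, n)) t :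
  D t -> sigma_mx (X t) `<=` sigma_proc D X.
Proof. by move=> Dt A XA; apply: sub_sigma_algebra; exists t. Qed.

Lemma sigma_joinl (F G : set (set T)) : F `<=` sigma_join F G.
Proof. by move=> A FA; apply: sub_sigma_algebra; left. Qed.

Lemma sigma_joinr (F G : set (set T)) : G `<=` sigma_join F G.
Proof. by move=> A GA; apply: sub_sigma_algebra; right. Qed.

End SigmaAlgebraClosure.

Section SubSigmaAlgebra.
Context d (T : measurableType d) (R : realType).

Lemma g_sigma_measurable (G : set (set T)) : G `<=` measurable -> <<s G >> `<=` measurable.
Proof. by move=> Gm; apply: smallest_sub => //; exact: sigma_algebra_measurable. Qed.

Lemma sigma_proc_measurable m n (D : set nat) (X : nat -> T -> 'M[R]_(m, n)) :
  (forall t, random_mx (X t)) -> sigma_proc D X `<=` measurable.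
Proof.
by move=> mX; apply: g_sigma_measurable => A [t _]; exact: sigma_mx_measurable.
Qed.

Lemma sigma_join_measurable (F G : set (set T)) :
  F `<=` measurable -> G `<=` measurable -> sigma_join F G `<=` measurable.
Proof. by move=> Fm Gm; apply: g_sigma_measurable => A [/Fm|/Gm]. Qed.

End SubSigmaAlgebra.

(** * The random choice of the influence matrix, independent of the history *)

Section Gossip.
Context (R : realType) d (T : measurableType d) (Pr : probability T R) (n : nat).
Context (P : 'M[R]_n) (alpha : R) (Pt : nat -> T -> 'M[R]_n) (F : set (set T)).
Hypothesis Pt_rv : forall t, random_mx (Pt t).
Hypothesis Pt_law : forall t, gossip_law Pr alpha P (Pt t).
Hypothesis Pt_indep : independent_family Pr (fun t => sigma_mx (Pt t)).
Hypothesis F_measurable : F `<=` measurable.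
Hypothesis FI : setI_closed F.
Hypothesis FT : F setT.
Hypothesis Pt_indep_F : independent_pair Pr (sigma_proc setT Pt) F.

Definition active t := [set w | Pt t w = P].

(* A version of [Pt] whose values are exactly [P] and the identity. *)
Definition gossip t w : 'M[R]_n := if Pt t w == P then P else 1%:M.

(* The two atoms of the gossip law coincide when [P] is the identity, and the
   probability of [active t] is then 1. *)
Definition active_prob : R := alpha + (1 - alpha) * (P == 1%:M)%:R.

Lemma sigma_mx_active t : sigma_mx (Pt t) (active t).
Proof. exact: sigma_mx_point. Qed.

Lemma measurable_active t : measurable (active t).
Proof. exact: sigma_mx_measurable (@sigma_mx_active t). Qed.

Lemma probability_active t : Pr (active t) = active_prob%:E.
Proof. by rewrite /active Pt_law eqxx mulr1. Qed.

Lemma gossipE t w : gossip t w = 1%:M + \1_(active t) w *: (P - 1%:M).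
Proof.
rewrite /gossip indicE; case: eqP => PtP.
  by rewrite mem_set//= scale1r addrC subrK.
by rewrite memNset//= scale0r addr0.
Qed.

(** When [P] is the identity, [active_prob] differs from [alpha] in general, but it multiplies
    [P - 1], which is 0. *)
Lemma mean_influence_active : mean_influence alpha P = 1%:M + active_prob *: (P - 1%:M).
Proof.
rewrite /active_prob /mean_influence; have [->|_] := eqVneq P 1%:M.
  by rewrite subrr scaler0 addr0 -scalerDl subrK scale1r.
by rewrite mulr0 addr0 scalerBl scale1r scalerBr addrA addrAC.
Qed.

(** The atoms exhaust the mass: their probabilities add up to 1, or, when [P] is the identity, the
    single atom has probability 1. *)
Lemma gossip_ae : {ae Pr, forall w, forall t, Pt t w = gossip t w}.
Proof.
apply: ae_foralln => t.
pose N := ~` ([set w | Pt t w = P] `|` [set w | Pt t w = 1%:M]).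
have mP Q : measurable [set w | Pt t w = Q].
  by apply: (sigma_mx_measurable (Pt_rv t)); exact: sigma_mx_point.
have PN : Pr N = 0%E.
  rewrite probability_setC; last exact: measurableU.
  have [P1|P1] := eqVneq P 1%:M.
    by rewrite P1 setUid Pt_law P1 eqxx !mulr1 subrKC subee.
  have -> : (Pr ([set w | Pt t w = P] `|` [set w | Pt t w = 1%:M]) = 1)%E; last by rewrite subee.
  rewrite measureU//.
    apply: etrans (congr2 adde (Pt_law t P) (Pt_law t 1%:M)) _.
    rewrite !eqxx (negbTE P1) eq_sym (negbTE P1) !mulr1 !mulr0 addr0 add0r.
    by rewrite -[LHS]EFinD subrKC.
  by apply/seteqP; split => // w /= [-> P1']; move: P1; rewrite P1' eqxx.
exists N; split; [by apply: measurableC; exact: measurableU|exact: PN|].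
move=> w /= ; apply: contra_not => -[PP|P1]; rewrite /gossip; first by rewrite PP eqxx.
by case: eqP.
Qed.

(* A pi-system that generates the sigma-algebra of [Pt 0, ..., Pt (t - 1)] and [F]. *)
Definition history t : set (set T) :=
  [set A | exists E C, [/\ forall s, sigma_mx (Pt s) (E s), F C &
    A = (\big[setI/setT]_(s <- iota 0 t) E s) `&` C]].

Lemma history_measurable t : history t `<=` measurable.
Proof.
move=> _ [E [C [PE FC ->]]]; apply: measurableI; last exact: F_measurable.
by apply: bigsetI_measurable => s _; exact: sigma_mx_measurable (PE s).
Qed.

Lemma historyI t : setI_closed (history t).
Proof.
move=> _ _ [E [C [PE FC ->]]] [E' [C' [PE' FC' ->]]].
exists (fun s => E s `&` E' s), (C `&` C'); split; [|exact: FI|].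
  by move=> s; exact: g_sigmaI (PE s) (PE' s).
by rewrite big_split/= setIACA.
Qed.

Lemma history_matrix t s E : (s < t)%N -> sigma_mx (Pt s) E -> history t E.
Proof.
move=> st PE; exists (fun r => if r == s then E else setT), setT; split => //.
  by move=> r; case: eqP => [->//|_]; exact: g_sigmaT.
rewrite setIT (bigD1_seq s) ?iota_uniq ?mem_iota ?add0n//= eqxx big1 ?setIT// => r.
by move/negbTE => ->.
Qed.

Lemma history_input t : F `<=` history t.
Proof.
move=> C FC; exists (fun=> setT), C; split => //; first by move=> s; exact: g_sigmaT.
by rewrite big1 ?setTI.
Qed.

(** On a generator of the history, independence from [F] splits off [C], and independence of the
    matrices over time splits off [active t]. The pi-system argument does the rest. *)
Lemma active_indep_history t A : <<s history t >> A ->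
  Pr (active t `&` A) = (Pr (active t) * Pr A)%E.
Proof.
apply: independent_pair_g_sigma; [exact: measurable_active|exact: history_measurable|
  exact: historyI|exact: history_input|].
move=> _ [E [C [PE FC ->]]].
have Psub s : sigma_mx (Pt s) `<=` sigma_proc setT Pt by exact: sigma_proc_sub.
have procI : sigma_proc setT Pt (\big[setI/setT]_(s <- iota 0 t) E s).
  by apply: g_sigma_bigI => s _; apply: Psub; exact: PE.
rewrite setIA Pt_indep_F//; last first.
  by apply: g_sigmaI => //; apply: Psub; exact: sigma_mx_active.
rewrite (Pt_indep_F procI)// muleA; congr (_ * _)%E.
(* Independence of a family takes one event per index, so [active t] is inserted at the index [t],
   absent from [iota 0 t]. *)
pose E' s := if s == t then active t else E s.
have E's : \big[setI/setT]_(s <- iota 0 t) E' s = \big[setI/setT]_(s <- iota 0 t) E s.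
  apply: eq_big_seq => s; rewrite mem_iota add0n => /andP[_ st].
  by rewrite /E' ltn_eqF.
have -> : active t `&` \big[setI/setT]_(s <- iota 0 t) E s =
    \big[setI/setT]_(s <- t :: iota 0 t) E' s.
  by rewrite big_cons E's /E' eqxx.
have PE' s : sigma_mx (Pt s) (E' s).
  by rewrite /E'; case: eqP => [->|_]; [exact: sigma_mx_active|exact: PE].
rewrite (@Pt_indep (t :: iota 0 t) E')//; last first.
  by rewrite /= iota_uniq andbT mem_iota add0n ltnn.
rewrite -E's (@Pt_indep (iota 0 t) E') ?iota_uniq//.
by rewrite big_cons {1}/E' eqxx.
Qed.

Lemma active_centered_history t Z : bounded_rv Z -> measurable_wrt <<s history t >> Z ->
  Ex Pr (fun w => (\1_(active t) w - active_prob) * Z w) = 0.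
Proof.
move=> bZ HZ; have bA := @bounded_rv_indic _ _ R _ (@measurable_active t).
apply: (@Ex_orthogonal _ _ _ _ <<s history t >>) => //.
  by apply: bounded_rvB => //; exact: bounded_rv_cst.
move=> A HA; have mA := g_sigma_measurable (@history_measurable t) HA.
have bA' := @bounded_rv_indic _ _ R _ mA.
under eq_fun do rewrite mulrBl.
rewrite ExB; [|exact: bounded_rvM|exact: bounded_rvZ].
rewrite ExZ// (_ : (fun w => _) = \1_(active t `&` A)); last by apply/funext => w; rewrite indicI.
rewrite !Ex_indic//; last by apply: measurableI => //; exact: measurable_active.
by rewrite active_indep_history// probability_active fineM ?fin_num_measure// subrr.
Qed.

End Gossip.
(** * Forward and backward iterations *)

Section Iteration.
Context (A Z : Type) (f : A -> Z -> Z).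

Fixpoint fwd (a : nat -> A) (z : Z) (t : nat) : Z :=
  if t is t'.+1 then f (a t') (fwd a z t') else z.

(** The letter [a 0] is outermost and each new letter enters innermost, next to [z]; in [fwd] the
    new letter is outermost. *)
Fixpoint bwd (a : nat -> A) (z : Z) (t : nat) : Z :=
  if t is t'.+1 then bwd a (f (a t') z) t' else z.

Lemma fwd_shift a z t : fwd a z t.+1 = fwd (fun s => a s.+1) (f (a 0%N) z) t.
Proof. by elim: t => // t IH; rewrite -/(fwd _ _ t.+1) /= -IH. Qed.

Lemma bwd_fwd a z t : bwd a z t = fwd (fun s => a (t - s.+1)%N) z t.
Proof. by elim: t z => // t IH z; rewrite fwd_shift subSS subn0 /= IH. Qed.

End Iteration.

Section AffineIteration.
Context (R : realType) (n : nat) (P : 'M[R]_n) (lam : 'rV[R]_n) (eta0 : 'cV[R]_n).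
Hypothesis P_stoch : row_stochastic P.
Hypothesis lam01 : forall v, 0 <= lam 0 v <= 1.

Definition update (bh : bool * 'cV[R]_n) (z : 'cV[R]_n) : 'cV[R]_n :=
  diag_mx lam *m (if bh.1 then P else 1%:M) *m z + (1%:M - diag_mx lam) *m (eta0 + bh.2).

Lemma update_entry bh z v : update bh z v 0 =
  lam 0 v * (\sum_j (if bh.1 then P else 1%:M) v j * z j 0) + (1 - lam 0 v) * (eta0 v 0 + bh.2 v 0).
Proof.
rewrite /update mxE diag_mul_entry mulmxBl mul1mx mul_diag_mx; congr (_ + _).
by rewrite !mxE mulrBl mul1r.
Qed.

Let choice_stoch (b : bool) : row_stochastic (if b then P else 1%:M).
Proof. by case: b => //; exact: row_stochastic1. Qed.

Lemma update_le bh (z1 z2 : 'cV[R]_n) : (forall v, z1 v 0 <= z2 v 0) ->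
  forall v, update bh z1 v 0 <= update bh z2 v 0.
Proof.
move=> z12 v; rewrite !update_entry lerD2r ler_wpM2l//; first by case/andP: (lam01 v).
by rewrite ler_sum// => j _; rewrite ler_wpM2l//; exact: (choice_stoch bh.1).1.
Qed.

Lemma update_unit_box bh z : unit_box (eta0 + bh.2) -> unit_box z -> unit_box (update bh z).
Proof.
move=> h01 z01 v; rewrite update_entry; have := h01 v; rewrite mxE.
set q := \sum_j _; set e := (X in 0 <= X <= 1 -> _) => /andP[e0 e1].
have Q0 w j : 0 <= (if bh.1 then P else 1%:M) w j by exact: (choice_stoch bh.1).1.
have q0 : 0 <= q by apply: sumr_ge0 => j _; rewrite mulr_ge0//; case/andP: (z01 j).
have q1 : q <= 1.
  rewrite -(row_stochastic_sum v (choice_stoch bh.1)) ler_sum// => j _.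
  by rewrite ler_piMr//; case/andP: (z01 j).
rewrite -/e; move: q e e0 e1 q0 q1 => q e e0 e1 q0 q1.
by have /andP[l0 l1] := lam01 v; apply/andP; split; nra.
Qed.

Lemma fwd_le a (z1 z2 : 'cV[R]_n) t : (forall v, z1 v 0 <= z2 v 0) ->
  forall v, fwd update a z1 t v 0 <= fwd update a z2 t v 0.
Proof. by move=> z12; elim: t => //= t IH; exact: update_le. Qed.

Lemma bwd_le a (z1 z2 : 'cV[R]_n) t : (forall v, z1 v 0 <= z2 v 0) ->
  forall v, bwd update a z1 t v 0 <= bwd update a z2 t v 0.
Proof. by elim: t z1 z2 => //= t IH z1 z2 z12; apply: IH; exact: update_le. Qed.

Lemma fwd_unit_box a z t : (forall s, unit_box (eta0 + (a s).2)) -> unit_box z ->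
  unit_box (fwd update a z t).
Proof. by move=> a01 z01; elim: t => //= t IH; exact: update_unit_box. Qed.

Lemma bwd_unit_box a z t : (forall s, unit_box (eta0 + (a s).2)) -> unit_box z ->
  unit_box (bwd update a z t).
Proof. by move=> a01; elim: t z => //= t IH z z01; apply: IH; exact: update_unit_box. Qed.

Lemma unit_box0 : unit_box (0 : 'cV[R]_n).
Proof. by move=> v; rewrite mxE lexx ler01. Qed.

(** One more letter replaces the innermost 0 by its update, which lies in the box and is thus above
    0; the outer maps preserve the order. *)
Lemma bwd_nondecreasing a v : (forall s, unit_box (eta0 + (a s).2)) ->
  nondecreasing_seq (fun t => bwd update a 0 t v 0).
Proof.
move=> a01; apply/nondecreasing_seqP => t; apply: bwd_le => u; rewrite [leLHS]mxE.
by have /andP[] := @update_unit_box (a t) 0 (a01 t) unit_box0 u.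
Qed.

Lemma bwd_cvg a v : (forall s, unit_box (eta0 + (a s).2)) ->
  bwd update a 0 t v 0 @[t --> \oo] --> sup (range (fun t => bwd update a 0 t v 0)).
Proof.
move=> a01; apply: nondecreasing_cvgn; first exact: bwd_nondecreasing.
by exists 1 => _ [t _ <-]; case/andP: (bwd_unit_box t a01 unit_box0 v).
Qed.

End AffineIteration.

(** * Invariance of the law of the inputs under time reversal *)

Section TimeReversal.
Context (R : realType) d (T : measurableType d) (Pr : probability T R) (n : nat).
Context (P : 'M[R]_n) (lam : 'rV[R]_n) (eta0 : 'cV[R]_n) (alpha : R).
Context (Pt : nat -> T -> 'M[R]_n) (eta_nc : nat -> T -> 'cV[R]_n).
Hypothesis Pt_rv : forall t, random_mx (Pt t).
Hypothesis eta_nc_rv : forall t, random_mx (eta_nc t).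
Hypothesis Pt_law : forall t, gossip_law Pr alpha P (Pt t).
Hypothesis Pt_indep : independent_family Pr (fun t => sigma_mx (Pt t)).
Hypothesis Pt_indep_noise : independent_pair Pr (sigma_proc setT Pt) (sigma_proc setT eta_nc).
Hypothesis noise_indep : independent_family Pr (fun t => sigma_mx (eta_nc t)).
Hypothesis noise_law : forall t, same_law Pr (eta_nc t) (eta_nc 0%N).

(** Only whether [P] is drawn is recorded, as in [gossip]: an event on a boolean is one of four, and
    its probability is known from the mass of [active]. *)
Definition letters (w : T) (s : nat) : bool * 'cV[R]_n := (Pt s w == P, eta_nc s w).

Definition letter_rectangle t (D : nat -> set bool) (C : nat -> set 'cV[R]_n) :=
  [set a : nat -> bool * 'cV[R]_n | forall s, (s < t)%N -> D s (a s).1 /\ C s (a s).2].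

Definition letter_rectangles t : set (set (nat -> bool * 'cV[R]_n)) :=
  [set A | exists D C, (forall s, sigma_mx (@id 'cV[R]_n) (C s)) /\ A = letter_rectangle t D C].

Lemma letter_rectanglesI t : setI_closed (letter_rectangles t).
Proof.
move=> _ _ [D [C [mC ->]]] [D' [C' [mC' ->]]].
exists (fun s => D s `&` D' s), (fun s => C s `&` C' s); split.
  by move=> s; exact: g_sigmaI (mC s) (mC' s).
apply/seteqP; split => a /=.
  by move=> [h h'] s st; have [? ?] := h s st; have [? ?] := h' s st.
by move=> h; split=> s st; have [[? ?] [? ?]] := h s st.
Qed.

Lemma letter_rectanglesT t : letter_rectangles t setT.
Proof.
exists (fun=> setT), (fun=> setT); split; first by move=> s; exact: g_sigmaT.
by apply/seteqP; split.
Qed.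

Lemma bool_event_cases s (D : set bool) :
  [set w | D (Pt s w == P)] = (if `[< D true >] then active P Pt s else set0) `|`
    (if `[< D false >] then ~` active P Pt s else set0).
Proof.
apply/seteqP; split => w /=; rewrite /active.
  case: eqP => /= PtP DP; [left|right]; rewrite asboolT//.
by move=> [|]; case: asboolP => // D' /=; [move=> ->; rewrite eqxx|move/eqP/negbTE => ->].
Qed.

Lemma sigma_mx_bool_event s (D : set bool) : sigma_mx (Pt s) [set w | D (Pt s w == P)].
Proof.
set G := \bigcup_(ij in [set: 'I_n * 'I_n]) sigma_entry (Pt s) ij.1 ij.2.
have mA : <<s G >> (active P Pt s) by exact: sigma_mx_active.
have ifG (b : bool) X : <<s G >> X -> <<s G >> (if b then X else set0).
  by case: b => // _; exact: (@measurable0 _ (g_sigma_algebraType G)).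
rewrite bool_event_cases; apply: (@measurableU _ (g_sigma_algebraType G)); apply: ifG => //.
exact: (@measurableC _ (g_sigma_algebraType G)).
Qed.

Lemma probability_bool_event s (D : set bool) :
  Pr [set w | D (Pt s w == P)] = Pr [set w | D (Pt 0%N w == P)].
Proof.
have mA t : measurable (active P Pt t) by exact: measurable_active.
have PA t : Pr (active P Pt t) = (active_prob P alpha)%:E by exact: probability_active.
rewrite !bool_event_cases; case: asboolP => _; case: asboolP => _; rewrite ?setUv ?setU0 ?set0U//.
  by rewrite !PA.
by rewrite !probability_setC// !PA.
Qed.

(** Independence gives a product of one-letter factors, each brought back to time 0 because the laws
    do not change with time. The result depends on time only through [D] and [C], so permuting the
    times permutes the factors. *)
Lemma letters_rectangle t D C : (forall s, sigma_mx (@id 'cV[R]_n) (C s)) ->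
  measurable (letters @^-1` letter_rectangle t D C) /\
  Pr (letters @^-1` letter_rectangle t D C) =
  ((\prod_(s < t) Pr [set w | D s (Pt 0%N w == P)]) *
   (\prod_(s < t) Pr [set w | C s (eta_nc 0%N w)]))%E.
Proof.
move=> mC.
pose E s := [set w | D s (Pt s w == P)].
pose H s := [set w | C s (eta_nc s w)].
have PE s : sigma_mx (Pt s) (E s) by exact: sigma_mx_bool_event.
have PH s : sigma_mx (eta_nc s) (H s) by exact: sigma_mx_preimage (mC s).
have -> : letters @^-1` letter_rectangle t D C =
    (\big[setI/setT]_(s <- iota 0 t) E s) `&` (\big[setI/setT]_(s <- iota 0 t) H s).
  rewrite -!bigcap_seq; apply/seteqP; split => w /=.
    by move=> h; split=> s /=; rewrite mem_iota add0n => /h[].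
  by move=> [h h'] s st; split; [apply: h|apply: h'] => /=; rewrite mem_iota add0n.
have sE : sigma_proc setT Pt (\big[setI/setT]_(s <- iota 0 t) E s).
  by apply: g_sigma_bigI => s _; apply: (@sigma_proc_sub _ _ _ _ _ _ s) => //; exact: PE.
have sH : sigma_proc setT eta_nc (\big[setI/setT]_(s <- iota 0 t) H s).
  by apply: g_sigma_bigI => s _; apply: (@sigma_proc_sub _ _ _ _ _ _ s) => //; exact: PH.
split.
  apply: measurableI.
    by apply: sigma_proc_measurable sE.
  by apply: sigma_proc_measurable sH.
rewrite Pt_indep_noise// (Pt_indep (iota_uniq 0 t))// (noise_indep (iota_uniq 0 t))//.
rewrite -{1 2}(subn0 t) -/(index_iota 0 t) !big_mkord; congr (_ * _)%E; apply: eq_bigr => s _.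
  exact: probability_bool_event.
exact: (noise_law _ (mC s)).
Qed.

(* The bounds [s < t] matter: [t - s.+1] is an involution of [0, t[ only. *)
Lemma letter_rectangle_reversal t D C :
  (fun w s => letters w (t - s.+1)%N) @^-1` letter_rectangle t D C =
  letters @^-1` letter_rectangle t (fun s => D (t - s.+1)%N) (fun s => C (t - s.+1)%N).
Proof.
have st s : (s < t)%N -> (t - s.+1 < t)%N by move=> st; rewrite ltn_subrL (leq_ltn_trans _ st).
have inv s : (s < t)%N -> (t - (t - s.+1).+1)%N = s by move=> h; rewrite subnSK// subKn// ltnW.
apply/seteqP; split => w /= h s hs.
  by have := h _ (st _ hs); rewrite inv.
by have := h _ (st _ hs); rewrite inv.
Qed.

(** The first [t] letters and their reversal have the same law, and the forward composition of the
    reversed word is the backward composition. The identity holds at one [t], not for the two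
    processes jointly. *)
Lemma Ex_time_reversal t (g : 'cV[R]_n -> R) :
  measurable_wrt <<s letter_rectangles t >> (fun a => g (fwd (update P lam eta0) a 0 t)) ->
  bounded_rv (fun w => g (fwd (update P lam eta0) (letters w) 0 t)) ->
  bounded_rv (fun w => g (bwd (update P lam eta0) (letters w) 0 t)) ->
  Ex Pr (fun w => g (fwd (update P lam eta0) (letters w) 0 t)) =
  Ex Pr (fun w => g (bwd (update P lam eta0) (letters w) 0 t)).
Proof.
move=> mg bf; under eq_fun do rewrite bwd_fwd; move=> bb.
apply: (@same_law_g_sigma _ _ _ Pr _ (letter_rectangles t) letters
  (fun w s => letters w (t - s.+1)%N) (fun a => g (fwd (update P lam eta0) a 0 t))) => //.
- exact: letter_rectanglesI.
- exact: letter_rectanglesT.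
- by move=> _ [D [C [mC ->]]]; exact: (letters_rectangle t D mC).1.
- move=> _ [D [C [mC ->]]]; rewrite letter_rectangle_reversal.
  by apply: (letters_rectangle t _ _).1 => s; exact: mC.
- move=> _ [D [C [mC ->]]]; rewrite letter_rectangle_reversal.
  rewrite !(letters_rectangle t _ _).2//; congr (_ * _)%E.
    by rewrite (reindex_inj rev_ord_inj).
  by rewrite (reindex_inj rev_ord_inj).
Qed.

Lemma letter_fwd_measurable t s v : (s <= t)%N ->
  measurable_wrt <<s letter_rectangles t >> (fun a => fwd (update P lam eta0) a 0 s v 0).
Proof.
elim: s v => [|s IH] v st.
  by under eq_fun do rewrite /= mxE; exact: measurable_wrt_cst.
under eq_fun do rewrite /= update_entry.
apply: measurable_wrtD; apply: measurable_wrtZ.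
  apply: measurable_wrt_sum => j; apply: measurable_wrtM; last by apply: IH; exact: ltnW.
  move=> B mB; apply: sub_sigma_algebra.
  exists (fun r => if r == s then [set b : bool | B ((if b then P else 1%:M) v j)] else setT),
    (fun=> setT).
  split; first by move=> r; exact: g_sigmaT.
  apply/seteqP; split => a /=; first by move=> Ba r rt; case: eqP => // ->.
  by move=> /(_ s st)[]; rewrite eqxx.
apply: measurable_wrtD; first exact: measurable_wrt_cst.
move=> B mB; apply: sub_sigma_algebra.
exists (fun=> setT), (fun r => if r == s then [set h : 'cV[R]_n | B (h v 0)] else setT); split.
  by move=> r; case: eqP => _; [exact: (sigma_mx_entry (X := id))|exact: g_sigmaT].
apply/seteqP; split => a /=; first by move=> Ba r rt; case: eqP => // ->.
by move=> /(_ s st)[_]; rewrite eqxx.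
Qed.

Lemma letter_fwd_random t :
  @random_mx _ (g_sigma_algebraType (letter_rectangles t)) R n 1
    (fun a => fwd (update P lam eta0) a 0 t).
Proof.
by move=> v j; rewrite ord1; apply/measurable_wrtP; exact: letter_fwd_measurable.
Qed.

End TimeReversal.
(** * The opinion process *)

Section Averages.
Context (R : realType).

Lemma cvg_inv_natr : (t%:R^-1 : R) @[t --> \oo] --> 0.
Proof. by rewrite -(cvg_shiftS (fun t : nat => t%:R^-1 : R)); exact: cvg_harmonic. Qed.

(** The sum of [z (l + 1) - M z l - c] is [1 - M] applied to the sum of the [z l], plus [z t - z 0],
    minus [t c]. In the box the boundary term is bounded and disappears after division by [t]. *)
Lemma cvg_average_resolvent n (M : 'M[R]_n) (c : 'cV[R]_n) (z : nat -> 'cV[R]_n) :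
  1%:M - M \in unitmx -> (forall t, unit_box (z t)) ->
  (forall v, t%:R^-1 * (\sum_(l < t) (z l.+1 - M *m z l - c) v 0) @[t --> \oo] --> 0) ->
  forall v, t%:R^-1 * (\sum_(l < t) z l v 0) @[t --> \oo] --> (invmx (1%:M - M) *m c) v 0.
Proof.
move=> Mu z01 dz v.
pose a t : 'cV[R]_n := t%:R^-1 *: \sum_(l < t) z l.
have aE t u : a t u 0 = t%:R^-1 * \sum_(l < t) z l u 0 by rewrite /a mxE summxE.
under eq_fun do rewrite -aE -[a _](mulKmx Mu).
apply: cvg_mulmx => u.
have zb : t%:R^-1 * (z t u 0 - z 0%N u 0) @[t --> \oo] --> 0.
  apply/norm_cvg0P; apply: (squeeze_cvgr (f := fun=> 0) (h := fun t => t%:R^-1)).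
  - apply: nearW => t; rewrite normr_ge0/= normrM ger0_norm ?invr_ge0//.
    rewrite ler_piMr ?invr_ge0// ler_norml.
    by have /andP[? ?] := z01 t u; have /andP[? ?] := z01 0%N u; apply/andP; split; lra.
  - exact: cvg_cst.
  - exact: cvg_inv_natr.
have : t%:R^-1 * (\sum_(l < t) (z l.+1 - M *m z l - c) u 0) + c u 0 -
    t%:R^-1 * (z t u 0 - z 0%N u 0) @[t --> \oo] --> 0 + c u 0 - 0.
  by apply: cvgB => //; apply: cvgD => //; exact: cvg_cst.
rewrite add0r subr0; apply: cvg_trans; apply: near_eq_cvg.
(* At [t = 0] the inverse is 0 and the term [c] would be lost. *)
exists 1%N => // t /= t1.
have t0 : t%:R != 0 :> R by rewrite pnatr_eq0 -lt0n.
have -> : \sum_(l < t) (z l.+1 - M *m z l - c) u 0 =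
   (\sum_(l < t) ((1%:M - M) *m z l) u 0) + (z t u 0 - z 0%N u 0) - t%:R * c u 0.
  have -> : z t u 0 - z 0%N u 0 = \sum_(l < t) (z l.+1 u 0 - z l u 0).
    by rewrite -(big_mkord xpredT (fun l => z l.+1 u 0 - z l u 0)) telescope_sumr.
  rewrite -[t in t%:R]card_ord mulr_natl -sumr_const -big_split -sumrB/=; apply: eq_bigr => l _.
  by rewrite mulmxBl mul1mx !mxE; ring.
rewrite mulrBr mulKf// mulrDr.
rewrite /a -scalemxAr mxE mulmx_sumr summxE; ring.
Qed.
End Averages.

(** * Histories of the opinion process and its time averages *)

Section Model.
Context (R : realType) d (T : measurableType d) (Pr : probability T R) (n : nat).
Context (P : 'M[R]_n) (lam : 'rV[R]_n) (alpha : R) (eta0 : 'cV[R]_n) (sigma : 'I_n -> R).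
Context (Pt : nat -> T -> 'M[R]_n) (eta_nc x : nat -> T -> 'cV[R]_n).
Hypothesis P_stoch : row_stochastic P.
Hypothesis lam01 : forall v, 0 <= lam 0 v <= 1.
Hypothesis alpha01 : 0 <= alpha <= 1.
Hypothesis alpha_nondeg : alpha = 0 -> forall v, lam 0 v < 1.
Hypothesis eta0_01 : unit_box eta0.
Hypothesis Pt_rv : forall t, random_mx (Pt t).
Hypothesis eta_nc_rv : forall t, random_mx (eta_nc t).
Hypothesis x_rv : forall t, random_mx (x t).
Hypothesis Pt_law : forall t, gossip_law Pr alpha P (Pt t).
Hypothesis Pt_indep : independent_family Pr (fun t => sigma_mx (Pt t)).
Hypothesis Pt_indep_inputs : independent_pair Pr (sigma_proc setT Pt)
       (sigma_join (sigma_proc setT eta_nc) (sigma_mx (x 0%N))).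
Hypothesis eta01 : forall t w, unit_box (eta0 + eta_nc t w).
Hypothesis x01 : forall t w, unit_box (x t w).
Hypothesis x_dyn : forall t w, x t.+1 w =
       diag_mx lam *m Pt t w *m x t w + (1%:M - diag_mx lam) *m (eta0 + eta_nc t w).
Hypothesis noise : noise_assumption Pr sigma eta_nc x.
Hypothesis topology : topology_assumption P lam.

Let inputs := sigma_join (sigma_proc setT eta_nc) (sigma_mx (x 0%N)).
(** Only the matrices are limited to times below [t]: the whole noise and the initial state are
    included, so [x t] is measurable for [hist t] whatever their joint law. *)
Let hist := history Pt inputs.
Let p := active_prob P alpha.
Let M := diag_mx lam *m mean_influence alpha P.

Let inputs_measurable : inputs `<=` measurable.
Proof.
apply: sigma_join_measurable; first exact: sigma_proc_measurable.
exact: sigma_mx_measurable.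
Qed.

Let inputsI : setI_closed inputs. Proof. by move=> A B; exact: g_sigmaI. Qed.

Let inputsT : inputs setT. Proof. exact: g_sigmaT. Qed.

Let active_centered t Z : bounded_rv Z -> measurable_wrt <<s hist t >> Z ->
  Ex Pr (fun w => (\1_(active P Pt t) w - p) * Z w) = 0.
Proof. exact: active_centered_history. Qed.

Lemma noise_bounds t w v : -1 <= eta_nc t w v 0 <= 1.
Proof.
have := eta01 t w v; have := eta0_01 v; rewrite !mxE.
by move=> /andP[? ?] /andP[? ?]; apply/andP; split; lra.
Qed.

Lemma noise_bounded_rv t v : bounded_rv (fun w => eta_nc t w v 0).
Proof.
by split; [exact: eta_nc_rv|exists 1 => w; rewrite ler_norml; exact: noise_bounds].
Qed.

Lemma state_bounded_rv t v : bounded_rv (fun w => x t w v 0).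
Proof. by apply: bounded_rv_unit => //; [exact: x_rv|move=> w; exact: x01]. Qed.

Lemma active_bounded_rv t : bounded_rv (\1_(active P Pt t) : T -> R).
Proof. by apply: bounded_rv_indic; exact: measurable_active. Qed.

Lemma dynamics_entry (A : 'M[R]_n) (z h : 'cV[R]_n) v :
  (diag_mx lam *m A *m z + (1%:M - diag_mx lam) *m (eta0 + h)) v 0 =
  lam 0 v * (\sum_j A v j * z j 0) + (1 - lam 0 v) * (eta0 v 0 + h v 0).
Proof.
rewrite mxE diag_mul_entry mulmxBl mul1mx mul_diag_mx; congr (_ + _).
by rewrite !mxE mulrBl mul1r.
Qed.

Lemma history_entry s t i j : (s < t)%N -> measurable_wrt <<s hist t >> (fun w => Pt s w i j).
Proof.
move=> st B mB; apply: sub_sigma_algebra.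
by apply: (history_matrix _ st) => //; exact: sigma_mx_entry.
Qed.

Lemma history_active s t : (s < t)%N -> measurable_wrt <<s hist t >> (\1_(active P Pt s) : T -> R).
Proof.
move=> st; apply: measurable_wrt_indic; apply: sub_sigma_algebra.
by apply: (history_matrix _ st) => //; exact: sigma_mx_active.
Qed.

Lemma history_gossip s t i j : (s < t)%N ->
  measurable_wrt <<s hist t >> (fun w => gossip P Pt s w i j).
Proof.
move=> st; under eq_fun do rewrite gossipE !mxE.
apply: measurable_wrtD; first exact: measurable_wrt_cst.
apply: measurable_wrtM; last exact: measurable_wrt_cst.
exact: history_active.
Qed.

Lemma history_noise s t v : measurable_wrt <<s hist t >> (fun w => eta_nc s w v 0).
Proof.
move=> B mB; apply: sub_sigma_algebra; apply: history_input; apply: sigma_joinl.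
by apply: sigma_proc_sub; last exact: sigma_mx_entry.
Qed.

(** The matrices [A] are abstract in order to cover both [Pt], for the true state, and [gossip], for
    the processes driven by letters. *)
Lemma history_recursion (A : nat -> T -> 'M[R]_n) (z : nat -> T -> 'cV[R]_n) t :
  (forall s i j, (s < t)%N -> measurable_wrt <<s hist t >> (fun w => A s w i j)) ->
  (forall v, measurable_wrt <<s hist t >> (fun w => z 0%N w v 0)) ->
  (forall s w, z s.+1 w = diag_mx lam *m A s w *m z s w +
    (1%:M - diag_mx lam) *m (eta0 + eta_nc s w)) ->
  forall s v, (s <= t)%N -> measurable_wrt <<s hist t >> (fun w => z s w v 0).
Proof.
move=> mA mz0 zS; elim=> [v _|s IH v st]; first exact: mz0.
under eq_fun do rewrite zS dynamics_entry.
apply: measurable_wrtD; apply: measurable_wrtZ.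
  apply: measurable_wrt_sum => j; apply: measurable_wrtM; first exact: mA.
  by apply: IH; exact: ltnW.
by apply: measurable_wrtD; [exact: measurable_wrt_cst|exact: history_noise].
Qed.

Lemma history_state s t v : (s <= t)%N -> measurable_wrt <<s hist t >> (fun w => x s w v 0).
Proof.
move=> st; apply: (@history_recursion Pt x t) => //; first by move=> r i j rt; exact: history_entry.
move=> u B mB; apply: sub_sigma_algebra; apply: history_input; apply: sigma_joinr.
exact: sigma_mx_entry.
Qed.

(* Both terms are sequences of centered, bounded and uncorrelated variables. *)
Lemma innovation_ae : {ae Pr, forall w, forall v t,
  (x t.+1 w - M *m x t w - (1%:M - diag_mx lam) *m eta0) v 0 =
  lam 0 v * ((\1_(active P Pt t) w - p) * \sum_j (P - 1%:M) v j * x t w j 0) +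
  (1 - lam 0 v) * eta_nc t w v 0}.
Proof.
apply: filterS (gossip_ae Pt_rv Pt_law) => w Pw v t.
have -> : (x t.+1 w - M *m x t w - (1%:M - diag_mx lam) *m eta0) v 0 =
    x t.+1 w v 0 - (M *m x t w) v 0 - ((1%:M - diag_mx lam) *m eta0) v 0 by rewrite !mxE.
rewrite x_dyn dynamics_entry diag_mul_entry.
have -> : ((1%:M - diag_mx lam) *m eta0) v 0 = (1 - lam 0 v) * eta0 v 0.
  by rewrite mulmxBl mul1mx mul_diag_mx !mxE mulrBl mul1r.
have -> : \sum_j Pt t w v j * x t w j 0 = \sum_j mean_influence alpha P v j * x t w j 0 +
    (\1_(active P Pt t) w - p) * \sum_j (P - 1%:M) v j * x t w j 0.
  rewrite mulr_sumr -big_split/=; apply: eq_bigr => j _.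
  by rewrite Pw gossipE mean_influence_active -/p !mxE; ring.
ring.
Qed.

Lemma noise_centered t v : Ex Pr (fun w => eta_nc t w v 0) = 0.
Proof.
case: noise => _ _ /(_ t v) + _ _.
by rewrite (expectation_Ex _ (noise_bounded_rv t v)) => -[].
Qed.

Lemma noise_uncorrelated k l v : k != l ->
  Ex Pr (fun w => eta_nc k w v 0 * eta_nc l w v 0) = 0.
Proof.
move=> kl; rewrite (@Ex_independent _ _ _ Pr (sigma_mx (eta_nc k)) (sigma_mx (eta_nc l))).
- by rewrite noise_centered mul0r.
- exact: sigma_mx_measurable.
- exact: sigma_mx_measurable.
- move=> A B kA lB; have [[+ _] _ _ _ _] := noise.
  move=> /(_ [:: k; l] (fun i => if i == k then A else B)).
  rewrite !big_cons !big_nil eqxx [l == k]eq_sym (negbTE kl) setIT mule1; apply.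
    by rewrite /= inE kl.
  by move=> i; rewrite !inE => /orP[/eqP ->|/eqP ->]; rewrite ?eqxx// eq_sym (negbTE kl).
- exact: noise_bounded_rv.
- exact: noise_bounded_rv.
- exact: sigma_mx_entry.
- exact: sigma_mx_entry.
Qed.

Lemma state_average_ae : {ae Pr, forall w, forall v,
  t%:R^-1 * (\sum_(l < t) x l w v 0) @[t --> \oo] --> x_star alpha P lam eta0 v 0}.
Proof.
pose X1 v t w := lam 0 v * ((\1_(active P Pt t) w - p) * \sum_j (P - 1%:M) v j * x t w j 0).
pose X2 v t w := (1 - lam 0 v) * eta_nc t w v 0.
pose G v t w := \sum_j (P - 1%:M) v j * x t w j 0.
have bG v t : bounded_rv (G v t).
  by apply: bounded_rv_sum => j _; apply: bounded_rvZ; exact: state_bounded_rv.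
have bA t : bounded_rv (fun w => \1_(active P Pt t) w - p).
  by apply: bounded_rvB; [exact: active_bounded_rv|exact: bounded_rv_cst].
have bX1 v t : bounded_rv (X1 v t) by exact: (bounded_rvZ (lam 0 v) (bounded_rvM (bA t) (bG v t))).
have hG v s t : (s <= t)%N -> measurable_wrt <<s hist t >> (G v s).
  by move=> st; apply: measurable_wrt_sum => j; apply: measurable_wrtZ; exact: history_state.
have hX1 v s t : (s < t)%N -> measurable_wrt <<s hist t >> (X1 v s).
  move=> st; apply: measurable_wrtZ; apply: measurable_wrtM; last by apply: hG; exact: ltnW.
  by apply: measurable_wrtB; [exact: history_active|exact: measurable_wrt_cst].
have SX1 v : {ae Pr, forall w, t%:R^-1 * (\sum_(l < t) X1 v l w) @[t --> \oo] --> 0}.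
  apply: (@strong_law_uncorrelated _ _ _ _ _
    (`|lam 0 v| * ((1 + `|p|) * \sum_j `|(P - 1%:M) v j|))).
  - by move=> k; exact: (bX1 v k).1.
  - move=> k w; rewrite normrM ler_wpM2l// normrM ler_pM//.
      rewrite (le_trans (ler_normB _ _))// lerD2r indicE normr_nat lern1.
      exact: leq_b1.
    rewrite (le_trans (ler_norm_sum _ _ _))// ler_sum// => j _.
    by rewrite normrM ler_piMr//; have /andP[? ?] := x01 k w j; rewrite ger0_norm.
  - move=> k l kl; rewrite /X1.
    (* For [k < l], the term at time [k] and the state at time [l] are both known to [hist l]; only
       the centered activity at [l] is fresh. *)
    rewrite (_ : (fun w => _) =
        fun w => (\1_(active P Pt l) w - p) * (X1 v k w * (lam 0 v * G v l w))).
      apply: active_centered; first by apply: bounded_rvM => //; exact: bounded_rvZ.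
      by apply: measurable_wrtM; [exact: hX1|apply: measurable_wrtZ; exact: hG].
    by apply/funext => w; rewrite /X1 /G; ring.
have SX2 v : {ae Pr, forall w, t%:R^-1 * (\sum_(l < t) X2 v l w) @[t --> \oo] --> 0}.
  apply: (@strong_law_uncorrelated _ _ _ _ _ `|1 - lam 0 v|).
  - by move=> k; apply: (bounded_rvZ _ (noise_bounded_rv k v)).1.
  - by move=> k w; rewrite normrM ler_piMr// ler_norml; exact: noise_bounds.
  - move=> k l kl; rewrite /X2.
    rewrite (_ : (fun w => _) = fun w => (1 - lam 0 v) ^+ 2 * (eta_nc k w v 0 * eta_nc l w v 0)).
      rewrite ExZ ?noise_uncorrelated ?mulr0 ?ltn_eqF//.
      by apply: bounded_rvM; exact: noise_bounded_rv.
    by apply/funext => w; ring.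
have S v : {ae Pr, forall w, t%:R^-1 * (\sum_(l < t) (X1 v l w + X2 v l w)) @[t --> \oo] --> 0}.
  apply: filterS2 (SX1 v) (SX2 v) => w h1 h2.
  have := cvgD h1 h2; rewrite addr0 => h12.
  by under eq_fun do rewrite big_split/= mulrDr; exact: h12.
have {}S : {ae Pr, forall w, forall v,
    t%:R^-1 * (\sum_(l < t) (X1 v l w + X2 v l w)) @[t --> \oo] --> 0}.
  by apply: filter_forall.
apply: filterS2 innovation_ae S => w inn Sw v.
apply: (@cvg_average_resolvent _ n M ((1%:M - diag_mx lam) *m eta0) (x^~ w)) => [|t|u].
  exact: unitmx_resolvent.
  exact: x01.
by under eq_fun do under eq_bigr do rewrite inn; exact: Sw.
Qed.

(** * Coupling with the start from 0, and the limit state *)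

Let letter := letters P Pt eta_nc.
Let step := update P lam eta0.
(* [coupled] is almost surely [x]; it is driven by the same letters as [from0]. *)
Let from0 t w := fwd step (letter w) 0 t.
Let coupled t w := fwd step (letter w) (x 0%N w) t.
Let backward t w := bwd step (letter w) 0 t.

Let letter01 w s : unit_box (eta0 + (letter w s).2). Proof. exact: eta01. Qed.

Definition limit_state w : 'cV[R]_n :=
  \col_v sup (range (fun t => bwd (update P lam eta0) (letters P Pt eta_nc w) 0 t v 0)).

Lemma gossip_bounded_rv t i j : bounded_rv (fun w => gossip P Pt t w i j).
Proof.
under eq_fun do rewrite gossipE !mxE.
apply: bounded_rvD; first exact: bounded_rv_cst.
by apply: bounded_rvM; [exact: active_bounded_rv|exact: bounded_rv_cst].
Qed.

(** The reindexing [r] is the identity for the forward processes and the reversal of time for the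
    backward one. *)
Lemma letters_fwd_bounded_rv (r : nat -> nat) (z0 : T -> 'cV[R]_n) t v :
  (forall u, bounded_rv (fun w => z0 w u 0)) ->
  bounded_rv (fun w => fwd step (fun s => letter w (r s)) (z0 w) t v 0).
Proof.
move=> bz; elim: t v => [|t IH] v //=.
under eq_fun do rewrite /step update_entry.
apply: bounded_rvD; apply: bounded_rvZ.
  by apply: bounded_rv_sum => j _; apply: bounded_rvM => //; exact: gossip_bounded_rv.
by apply: bounded_rvD; [exact: bounded_rv_cst|exact: noise_bounded_rv].
Qed.

Lemma zero_bounded_rv (u : 'I_n) : bounded_rv (fun _ : T => (0 : 'cV[R]_n) u 0).
Proof. exact: bounded_rv_cst. Qed.

Lemma from0_bounded_rv t v : bounded_rv (fun w => from0 t w v 0).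
Proof. exact: (@letters_fwd_bounded_rv id (fun=> 0)) zero_bounded_rv. Qed.

Lemma coupled_bounded_rv t v : bounded_rv (fun w => coupled t w v 0).
Proof. by apply: (@letters_fwd_bounded_rv id) => u; exact: state_bounded_rv. Qed.

Lemma backward_bounded_rv t v : bounded_rv (fun w => backward t w v 0).
Proof.
rewrite /backward; under eq_fun do rewrite bwd_fwd.
exact: (@letters_fwd_bounded_rv _ (fun=> 0)) zero_bounded_rv.
Qed.

Lemma backward_cvg w v : backward t w v 0 @[t --> \oo] --> limit_state w v 0.
Proof. by rewrite mxE; exact: bwd_cvg. Qed.

Lemma backward_unit_box t w : unit_box (backward t w).
Proof. by apply: bwd_unit_box => //; exact: unit_box0. Qed.

Lemma backward_norm_le t w v : `|backward t w v 0| <= 1.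
Proof. by have /andP[? ?] := backward_unit_box t w v; rewrite ger0_norm. Qed.

Lemma from0_unit_box t w : unit_box (from0 t w).
Proof. by apply: fwd_unit_box => //; exact: unit_box0. Qed.

Lemma limit_state_unit_box w : unit_box (limit_state w).
Proof.
move=> v; apply/andP; split.
  apply: (cvgr_to_ge (@backward_cvg w v)).
  by apply: nearW => t /=; case/andP: (backward_unit_box t w v).
apply: (cvgr_to_le (@backward_cvg w v)).
by apply: nearW => t /=; case/andP: (backward_unit_box t w v).
Qed.

Lemma state_coupled_ae : {ae Pr, forall w, forall t, x t w = coupled t w}.
Proof.
apply: filterS (gossip_ae Pt_rv Pt_law) => w Pw; elim=> // t IH.
by rewrite x_dyn Pw IH.
Qed.

(** The activity at time [t] is centered relative to [hist t], which knows [z t], so the random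
    matrix averages out to [mean_influence]; the noise contributes only its zero mean. *)
Lemma mean_recursion (z : nat -> T -> 'cV[R]_n) :
  (forall t v, bounded_rv (fun w => z t w v 0)) ->
  (forall t v, measurable_wrt <<s hist t >> (fun w => z 0%N w v 0)) ->
  (forall t w, z t.+1 w = step (letter w t) (z t w)) ->
  forall t, \col_v Ex Pr (fun w => z t.+1 w v 0) =
    M *m (\col_v Ex Pr (fun w => z t w v 0)) + (1%:M - diag_mx lam) *m eta0.
Proof.
move=> bz hz0 zS t; apply/matrixP => v j; rewrite ord1 mxE.
have hz s r u : (s <= r)%N -> measurable_wrt <<s hist r >> (fun w => z s w u 0).
  move=> sr; apply: (@history_recursion (gossip P Pt) z r) => // q i l qr.
  exact: history_gossip.
have bgz i l : bounded_rv (fun w => gossip P Pt t w i l * z t w l 0).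
  by apply: bounded_rvM => //; exact: gossip_bounded_rv.
have Egz i l : Ex Pr (fun w => gossip P Pt t w i l * z t w l 0) =
    mean_influence alpha P i l * Ex Pr (fun w => z t w l 0).
  rewrite (_ : (fun w => _) = fun w => mean_influence alpha P i l * z t w l 0 +
      (P - 1%:M) i l * ((\1_(active P Pt t) w - p) * z t w l 0)).
    rewrite ExD ?ExZ//.
    - by rewrite active_centered ?mulr0 ?addr0//; exact: hz.
    - apply: bounded_rvM => //.
      by apply: bounded_rvB; [exact: active_bounded_rv|exact: bounded_rv_cst].
    - exact: bounded_rvZ.
    - apply: bounded_rvZ; apply: bounded_rvM => //.
      by apply: bounded_rvB; [exact: active_bounded_rv|exact: bounded_rv_cst].
  by apply/funext => w; rewrite gossipE mean_influence_active -/p !mxE; ring.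
have -> : (fun w => z t.+1 w v 0) = fun w =>
    lam 0 v * (\sum_l gossip P Pt t w v l * z t w l 0) +
    (1 - lam 0 v) * (eta0 v 0 + eta_nc t w v 0).
  by apply/funext => w; rewrite zS /step update_entry.
have bn : bounded_rv (fun w => eta0 v 0 + eta_nc t w v 0).
  by apply: bounded_rvD; [exact: bounded_rv_cst|exact: noise_bounded_rv].
have bs : bounded_rv (fun w => \sum_l gossip P Pt t w v l * z t w l 0).
  by apply: bounded_rv_sum => l _.
rewrite ExD ?ExZ//; [|exact: bounded_rvZ|exact: bounded_rvZ].
rewrite ExD ?Ex_cst; [|exact: bounded_rv_cst|exact: noise_bounded_rv].
rewrite noise_centered addr0 Ex_sum// mxE diag_mul_entry; congr (_ * _ + _).
  by apply: eq_bigr => l _; rewrite Egz mxE.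
by rewrite mulmxBl mul1mx mul_diag_mx !mxE mulrBl mul1r.
Qed.

Lemma hist_zero t (v : 'I_n) : measurable_wrt <<s hist t >> (fun=> (0 : 'cV[R]_n) v 0).
Proof. exact: measurable_wrt_cst. Qed.

Lemma coupling_gap_mean v : Ex Pr (fun w => coupled t w v 0 - from0 t w v 0) @[t --> \oo] --> 0.
Proof.
pose u t : 'cV[R]_n :=
  \col_v Ex Pr (fun w => coupled t w v 0) - \col_v Ex Pr (fun w => from0 t w v 0).
have uE t j : u t j 0 = Ex Pr (fun w => coupled t w j 0 - from0 t w j 0).
  by rewrite !mxE ExB//; [exact: coupled_bounded_rv|exact: from0_bounded_rv].
under eq_fun do rewrite -uE.
apply: (contraction_cvg0 P_stoch lam01 alpha01 alpha_nondeg topology) => [j|t].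
  have b := bounded_rvB (coupled_bounded_rv 0 j) (from0_bounded_rv 0 j).
  rewrite uE; apply/andP; split.
    by apply: Ex_ge0 => w; rewrite /from0/= mxE subr0; case/andP: (x01 0 w j).
  rewrite -[leRHS](Ex_cst Pr); apply: Ex_le => //; first exact: bounded_rv_cst.
  by move=> w; rewrite /from0/= mxE subr0; case/andP: (x01 0 w j).
rewrite /u (mean_recursion coupled_bounded_rv)//; last first.
  by move=> r j; exact: history_state.
rewrite (mean_recursion from0_bounded_rv)//; last exact: hist_zero.
by rewrite mulmxBr opprD addrACA subrr addr0.
Qed.

Lemma Ex_from0_backward t (g : 'cV[R]_n -> R) : continuous g ->
  bounded_rv (g \o from0 t) -> bounded_rv (g \o backward t) ->
  Ex Pr (g \o from0 t) = Ex Pr (g \o backward t).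
Proof.
move=> cg bf bb; have [[ni nl] _ _ _ _] := noise.
apply: (@Ex_time_reversal _ _ _ Pr n P lam eta0 alpha Pt eta_nc) => //.
  move=> A B PA NB; apply: Pt_indep_inputs => //; exact: sigma_joinl NB.
apply/measurable_wrtP.
exact: measurable_fun_continuous_mx (letter_fwd_random P lam eta0 (t := t)) cg.
Qed.

Lemma limit_state_bounded_rv v : bounded_rv (fun w => limit_state w v 0).
Proof.
apply: (@Ex_dominated_cvg _ _ _ Pr (fun t w => backward t w v 0) _ 1 _ _ _).1.
- by move=> t; exact: (backward_bounded_rv t v).1.
- by move=> t w; exact: backward_norm_le.
- by move=> w; exact: backward_cvg.
Qed.

Lemma limit_state_random : random_mx limit_state.
Proof. by move=> v j; rewrite ord1; exact: (limit_state_bounded_rv v).1. Qed.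

(** The means of [from0] obey the affine recursion and, by time reversal, converge to the mean of
    the limit. That mean is a fixed point, and invertibility leaves only [x_star]. *)
Lemma limit_state_mean v : Ex Pr (fun w => limit_state w v 0) = x_star alpha P lam eta0 v 0.
Proof.
have cb u : Ex Pr (fun w => from0 t w u 0) @[t --> \oo] --> Ex Pr (fun w => limit_state w u 0).
  have [_] := @Ex_dominated_cvg _ _ _ Pr
    (fun t w => backward t w u 0) (fun w => limit_state w u 0) 1
    (fun t => (backward_bounded_rv t u).1)
    (fun t w => backward_norm_le t w u) (fun w => @backward_cvg w u).
  apply: cvg_trans; apply: near_eq_cvg; apply: nearW => t.
  apply/esym; apply: (Ex_from0_backward (g := fun z : 'cV[R]_n => z u 0)).
  - exact: coord_continuous.
  - exact: from0_bounded_rv.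
  - exact: backward_bounded_rv.
pose m : 'cV[R]_n := \col_u Ex Pr (fun w => limit_state w u 0).
pose mt t : 'cV[R]_n := \col_u Ex Pr (fun w => from0 t w u 0).
have mtm u : mt t u 0 @[t --> \oo] --> m u 0.
  by under eq_fun do rewrite mxE; rewrite mxE; exact: cb.
have mE : m = M *m m + (1%:M - diag_mx lam) *m eta0.
  apply/matrixP => u j; rewrite ord1 [RHS]mxE.
  have h1 : mt t.+1 u 0 @[t --> \oo] --> m u 0.
    by have := mtm u; rewrite -(cvg_shiftS (fun t => mt t u 0)).
  have h2 : mt t.+1 u 0 @[t --> \oo] --> (M *m m) u 0 + ((1%:M - diag_mx lam) *m eta0) u 0.
    under eq_fun do rewrite /mt (mean_recursion from0_bounded_rv hist_zero)// mxE.
    by apply: cvgD; [exact: cvg_mulmx mtm u|exact: cvg_cst].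
  exact: cvg_unique h1 h2.
have -> : Ex Pr (fun w => limit_state w v 0) = m v 0 by rewrite mxE.
rewrite /x_star -/M; congr (fun z : 'cV[R]_n => z v 0).
have {1}-> : (1%:M - diag_mx lam) *m eta0 = (1%:M - M) *m m.
  apply/esym/eqP; rewrite mulmxBl mul1mx subr_eq; apply/eqP.
  by rewrite [RHS]addrC.
by rewrite mulKmx//; exact: unitmx_resolvent.
Qed.

Lemma coupled_unit_box t w : unit_box (coupled t w).
Proof. by apply: fwd_unit_box => //; exact: x01. Qed.

(** The bound [K] is asked on the box only, so that the lemma also applies to Bernoulli weights,
    polynomials that are not bounded on the whole space in general. *)
Lemma state_cvg_law (f : 'cV[R]_n -> R) (K : R) : continuous f ->
  (forall z, unit_box z -> `|f z| <= K) ->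
  bounded_rv (f \o limit_state) /\ (forall t, bounded_rv (f \o x t)) /\
  Ex Pr (f \o x t) @[t --> \oo] --> Ex Pr (f \o limit_state).
Proof.
move=> cf fK.
have bf (X : T -> 'cV[R]_n) : (forall v, bounded_rv (fun w => X w v 0)) ->
    (forall w, unit_box (X w)) -> bounded_rv (f \o X).
  move=> bX X01; split; last by exists K => w; exact: fK.
  by apply: measurable_fun_continuous_mx => // v j; rewrite ord1; exact: (bX v).1.
have bx t : bounded_rv (f \o x t) by apply: bf (x01 t) => v; exact: state_bounded_rv.
have bc t : bounded_rv (f \o coupled t).
  by apply: bf (coupled_unit_box t) => v; exact: coupled_bounded_rv.
have b0 t : bounded_rv (f \o from0 t).
  by apply: bf (from0_unit_box t) => v; exact: from0_bounded_rv.
have bb t : bounded_rv (f \o backward t).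
  by apply: bf (backward_unit_box t) => v; exact: backward_bounded_rv.
have bl : bounded_rv (f \o limit_state).
  by apply: bf limit_state_unit_box => v; exact: limit_state_bounded_rv.
split=> //; split=> //.
have cb : Ex Pr (f \o from0 t) @[t --> \oo] --> Ex Pr (f \o limit_state).
  under eq_fun do rewrite Ex_from0_backward//.
  apply: (@Ex_dominated_cvg _ _ _ Pr (fun t => f \o backward t) (f \o limit_state) K _ _ _).2.
  - by move=> t; exact: (bb t).1.
  - by move=> t w; apply: fK; exact: backward_unit_box.
  - move=> w; apply: continuous_cvg; first exact: cf.
    by apply: cvg_mx => v j; rewrite ord1; exact: backward_cvg.
have K0 : 0 <= K by apply: le_trans (fK 0 (@unit_box0 R n)).
have xc t : Ex Pr (f \o x t) = Ex Pr (f \o coupled t).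
  apply: Ex_ae => //; apply: filterS state_coupled_ae => w h.
  by rewrite /= h.
under eq_fun do rewrite xc.
suff gap : Ex Pr (f \o coupled t) - Ex Pr (f \o from0 t) @[t --> \oo] --> 0.
  have h := cvgD gap cb; rewrite add0r in h.
  under eq_fun => t do rewrite -(subrK (Ex Pr (f \o from0 t)) (Ex Pr (f \o coupled t))).
  exact: h.
apply/cvgr0Pnorm_le => e e0.
have e2 : 0 < e / 2 by rewrite divr_gt0.
have [dl dl0 fdl] := uniform_continuity_unit_box cf e2.
pose S t w := \sum_v (coupled t w v 0 - from0 t w v 0).
have c0 t w v : 0 <= coupled t w v 0 - from0 t w v 0.
  rewrite subr_ge0; apply: fwd_le => // u; rewrite mxE.
  by case/andP: (x01 0 w u).
have bS t : bounded_rv (S t).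
  apply: bounded_rv_sum => v _.
  by apply: bounded_rvB; [exact: coupled_bounded_rv|exact: from0_bounded_rv].
(* If every coordinate gap is below [dl], uniform continuity gives [e / 2]; otherwise [S >= dl], and
   [2 K / dl * S] is at least the trivial bound [2 K]. *)
have pw t w : `|f (coupled t w) - f (from0 t w)| <= e / 2 + (2 * K / dl) * S t w.
  have S0 : 0 <= S t w by apply: sumr_ge0 => v _.
  have [/forallP near|far] := boolP [forall v, `|from0 t w v 0 - coupled t w v 0| < dl].
    rewrite distrC (le_trans (ltW (fdl _ _ (from0_unit_box t w) near)))//.
    by rewrite lerDl mulr_ge0// divr_ge0 ?mulr_ge0// ltW.
  have [v] : exists v, dl <= coupled t w v 0 - from0 t w v 0.
    move: far; rewrite negb_forall => /existsP[v]; rewrite -leNgt distrC ger0_norm// => h.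
    by exists v.
  move=> dv; have dS : dl <= S t w.
    apply: le_trans dv _; rewrite /S (bigD1 v)//= lerDl.
    by apply: sumr_ge0.
  have : 2 * K <= 2 * K / dl * S t w.
    by rewrite mulrAC ler_pdivlMr// ler_wpM2l// mulr_ge0.
  have := ler_normB (f (coupled t w)) (f (from0 t w)).
  have := fK _ (coupled_unit_box t w); have := fK _ (from0_unit_box t w); lra.
have ES : Ex Pr (S t) @[t --> \oo] --> 0.
  have -> : (fun t => Ex Pr (S t)) =
      fun t => \sum_v Ex Pr (fun w => coupled t w v 0 - from0 t w v 0).
    apply/funext => t; rewrite Ex_sum// => v _.
    by apply: bounded_rvB; [exact: coupled_bounded_rv|exact: from0_bounded_rv].
  have h : \sum_v Ex Pr (fun w => coupled t w v 0 - from0 t w v 0) @[t --> \oo] -->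
      \sum_(v < n) (0 : R).
    by apply: cvg_big => [|v _]; [exact: add_continuous|exact: coupling_gap_mean].
  by rewrite big1 in h.
(* The extra 1 keeps the divisor positive when [K] is 0. *)
have dKp : 0 < 2 * K / dl + 1 by rewrite ltr_wpDl// divr_ge0 ?mulr_ge0// ltW.
have e3 : 0 < e / 2 / (2 * K / dl + 1) by rewrite divr_gt0.
move/cvgr0Pnorm_le : ES => /(_ _ e3); apply: filterS => t.
have ES0 : 0 <= Ex Pr (S t) by apply: Ex_ge0 => w; apply: sumr_ge0 => v _.
rewrite ger0_norm// ler_pdivlMr// => hS.
rewrite -ExB//; have bD := bounded_rvB (bc t) (b0 t).
apply: le_trans (Ex_norm _ bD) _.
apply: (@le_trans _ _ (Ex Pr (fun w => e / 2 + (2 * K / dl) * S t w))).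
  apply: Ex_le; [exact: bounded_rv_norm|apply: bounded_rvD|move=> w; exact: pw].
    exact: bounded_rv_cst.
  exact: bounded_rvZ.
rewrite ExD ?Ex_cst ?ExZ//; [|exact: bounded_rv_cst|exact: bounded_rvZ].
rewrite [leRHS](splitr e) lerD2l (le_trans _ hS)// mulrDr mulr1 mulrC lerDl//.
Qed.

End Model.
(** * The acceptance process *)

Section BinaryVectors.
Context (R : realType) d (T : measurableType d) (n : nat) (Y : T -> 'cV[R]_n).
Hypothesis Y01 : forall w, binary_vec (Y w).

Definition binary_event (b : 'I_n -> bool) := [set w | forall u, Y w u 0 = (b u)%:R].

Lemma binary_decomposition (h : 'cV[R]_n -> R) w :
  h (Y w) = \sum_(b : {ffun 'I_n -> bool}) h (\col_u (b u)%:R) * \1_(binary_event b) w.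
Proof.
pose b0 : {ffun 'I_n -> bool} := [ffun u => Y w u 0 == 1].
have Yb0 u : Y w u 0 = (b0 u)%:R.
  by rewrite ffunE; case: (Y01 w u) => ->; rewrite ?eqxx// eq_sym oner_eq0.
rewrite (bigD1 b0)//= big1 => [|b bb0].
  rewrite indicE mem_set// mulr1 addr0; congr h; apply/matrixP => u j.
  by rewrite ord1 Yb0 mxE.
rewrite indicE memNset ?mulr0// => /= bY.
move/eqP: bb0; apply; apply/ffunP => u.
by have /eqP := bY u; rewrite Yb0 eqr_nat; case: (b u); case: (b0 u).
Qed.

Lemma measurable_binary_event b : random_mx Y -> measurable (binary_event b).
Proof.
move=> mY; rewrite (_ : binary_event b =
    \bigcap_(u in [set: 'I_n]) (fun w => Y w u 0) @^-1` [set (b u)%:R]).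
  apply: fin_bigcap_measurable => // u _; rewrite -[X in measurable X]setTI.
  by apply: mY => //; exact: measurable_set1.
by apply/seteqP; split => w h u; [move=> _|]; exact: h.
Qed.

(** On binary vectors any [h] is a finite combination of indicators of patterns, which makes
    [h \o Y] measurable and bounded. *)
Lemma Ex_binary (Pr : probability T R) (h : 'cV[R]_n -> R) : random_mx Y ->
  bounded_rv (h \o Y) /\ Ex Pr (h \o Y) =
  \sum_(b : {ffun 'I_n -> bool}) h (\col_u (b u)%:R) * fine (Pr (binary_event b)).
Proof.
move=> mY.
have bh (b : {ffun 'I_n -> bool}) :
    bounded_rv (fun w => h (\col_u (b u)%:R) * \1_(binary_event b) w).
  by apply: bounded_rvZ; apply: bounded_rv_indic; exact: measurable_binary_event.
have -> : h \o Y = fun w =>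
    \sum_(b : {ffun 'I_n -> bool}) h (\col_u (b u)%:R) * \1_(binary_event b) w.
  by apply/funext => w; exact: binary_decomposition.
split; first exact: bounded_rv_sum.
rewrite Ex_sum//; apply: eq_bigr => b _.
rewrite ExZ ?Ex_indic//; first exact: measurable_binary_event.
by apply: bounded_rv_indic; exact: measurable_binary_event.
Qed.

End BinaryVectors.

(** * Acceptances given the past *)

Section Acceptance.
Context (R : realType) d (T : measurableType d) (Pr : probability T R) (n : nat).
Context (x y : nat -> T -> 'cV[R]_n).
Hypothesis x_rv : forall t, random_mx (x t).
Hypothesis y_rv : forall t, random_mx (y t).
Hypothesis x01 : forall t w, unit_box (x t w).
Hypothesis y01 : forall t w, binary_vec (y t w).
Hypothesis acceptance_indep : independent_acceptances Pr x y.

Let past t := sigma_join (sigma_proc [set s | (s <= t)%N] x) (sigma_proc [set s | (s < t)%N] y).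

Let weight t (b : 'I_n -> bool) w := bernoulli_weight (fun v => x t w v 0) b.

Let past_measurable t : past t `<=` measurable.
Proof. by apply: sigma_join_measurable; exact: sigma_proc_measurable. Qed.

Lemma bernoulli_weight_bounded_rv t b : bounded_rv (weight t b).
Proof.
apply: bounded_rv_prod => v; case: (b v).
  by apply: bounded_rv_unit => //; [exact: x_rv|move=> w; exact: x01].
apply: bounded_rvB; first exact: bounded_rv_cst.
by apply: bounded_rv_unit => //; [exact: x_rv|move=> w; exact: x01].
Qed.

Let state_bounded t v : bounded_rv (fun w => x t w v 0).
Proof. by apply: bounded_rv_unit => //; [exact: x_rv|move=> w; exact: x01]. Qed.

Let accept_bounded t v : bounded_rv (fun w => y t w v 0).
Proof.
split; first exact: y_rv.
by exists 1 => w; case: (y01 t w v) => ->; rewrite ?normr0 ?normr1.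
Qed.

Lemma acceptance_event t b A : past t A ->
  fine (Pr (binary_event (y t) b `&` A)) = Ex Pr (fun w => weight t b w * \1_A w).
Proof.
move=> pA; have [_ _ ->//] := acceptance_indep t b.
by rewrite -Ex_restrict//; exact: past_measurable pA.
Qed.

(** The joint conditional probabilities of the patterns that accept at [v] add up to [x v]: the
    differences [y - x] are martingale differences. *)
Lemma acceptance_given_past t v A : past t A ->
  Ex Pr (fun w => (y t w v 0 - x t w v 0) * \1_A w) = 0.
Proof.
move=> pA; have mA := past_measurable pA; have bA := @bounded_rv_indic _ _ R _ mA.
under eq_fun do rewrite mulrBl.
rewrite ExB; [|exact: bounded_rvM|exact: bounded_rvM].
have mb b : measurable (binary_event (y t) b) by exact: measurable_binary_event.
rewrite (_ : (fun w => y t w v 0 * \1_A w) = fun w =>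
    \sum_(b : {ffun 'I_n -> bool} | b v) \1_(binary_event (y t) b `&` A) w); last first.
  apply/funext => w.
  rewrite (binary_decomposition (y01 t) (fun z : 'cV[R]_n => z v 0)) mulr_suml.
  rewrite [RHS]big_mkcond/=; apply: eq_bigr => b _; rewrite mxE indicI.
  by case: (b v); rewrite ?mul1r ?mul0r.
rewrite Ex_sum; last by move=> b _; apply: bounded_rv_indic; exact: measurableI.
have evE (b : 'I_n -> bool) :
    Ex Pr \1_(binary_event (y t) b `&` A) = Ex Pr (fun w => weight t b w * \1_A w).
  by rewrite Ex_indic ?acceptance_event//; exact: measurableI.
rewrite (eq_bigr _ (fun (b : {ffun 'I_n -> bool}) _ => evE b)).
rewrite -Ex_sum; last first.
  by move=> b _; apply: bounded_rvM => //; exact: bernoulli_weight_bounded_rv.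
apply/eqP; rewrite subr_eq0; apply/eqP; congr Ex; apply/funext => w.
by rewrite -mulr_suml (sum_bernoulli_weight_coord (fun u => x t w u 0)).
Qed.

Lemma acceptance_average_ae : {ae Pr, forall w, forall v,
  t%:R^-1 * (\sum_(l < t) (y l w v 0 - x l w v 0)) @[t --> \oo] --> 0}.
Proof.
apply: filter_forall => v.
have bD t : bounded_rv (fun w => y t w v 0 - x t w v 0) by exact: bounded_rvB.
apply: (@strong_law_uncorrelated _ _ _ _ (fun l w => y l w v 0 - x l w v 0) 1).
- by move=> k; exact: (bD k).1.
- move=> k w; have /andP[? ?] := x01 k w v; rewrite ler_norml.
  by case: (y01 k w v) => ->; apply/andP; split; lra.
- move=> k l kl; under eq_fun do rewrite mulrC.
  (* The difference at the later time [l] is orthogonal to [past l], which contains the earlier one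
     because [k < l]. *)
  apply: (@Ex_orthogonal _ _ _ _ (past l)) => //; last by move=> A; exact: acceptance_given_past.
  apply: measurable_wrtB; apply: (measurable_wrtS (F := _)).
  + apply: sigma_joinr.
  + by move=> B mB; apply: sigma_proc_sub; last exact: sigma_mx_entry.
  + apply: sigma_joinl.
  + by move=> B mB; apply: sigma_proc_sub; last exact: sigma_mx_entry; exact: ltnW.
Qed.

Lemma Ex_acceptance t (g : 'cV[R]_n -> R) : bounded_rv (g \o y t) /\
  Ex Pr (g \o y t) = \sum_(b : {ffun 'I_n -> bool}) g (\col_u (b u)%:R) * Ex Pr (weight t b).
Proof.
have [bg ->] := Ex_binary (y01 t) Pr g (y_rv t); split => //.
apply: eq_bigr => b _; congr (_ * _).
have pT : past t setT by exact: g_sigmaT.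
have := acceptance_event b pT; rewrite setIT => ->.
by under eq_fun do rewrite indicT mulr1.
Qed.

End Acceptance.
(** * The limit pair *)

(* A random choice in [I] with conditional law [p] is stored as a natural number
   through [pickle], for want of a measurable structure on [I]. *)
Section FiniteExtension.
Context (R : realType) d (T : measurableType d) (Pr : probability T R) (I : finType).
Context (p : I -> T -> R).
Hypothesis p_bounded : forall i, bounded_rv (p i).
Hypothesis p_ge0 : forall i w, 0 <= p i w.
Hypothesis p_sum : forall w, \sum_i p i w = 1.

Let density (A : set (T * nat)) w : R := \sum_i p i w * \1_A (w, pickle i).

Lemma indic_slice_bounded_rv (A : set (T * nat)) k : measurable A ->
  bounded_rv (fun w : T => \1_A (w, k) : R).
Proof.
move=> mA; split.
  by apply: (measurable_fun_pair1 k); exact: measurable_indic.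
by exists 1 => w; rewrite indicE normr_nat lern1 leq_b1.
Qed.

Lemma density_bounded_rv A : measurable A -> bounded_rv (density A).
Proof.
by move=> mA; apply: bounded_rv_sum => i _; apply: bounded_rvM => //; exact: indic_slice_bounded_rv.
Qed.

Lemma density_ge0 A w : 0 <= density A w.
Proof. by apply: sumr_ge0 => i _; rewrite mulr_ge0// indicE. Qed.

Let mu (A : set (T * nat)) : \bar R := (\int[Pr]_w (density A w)%:E)%E.

Let mu0 : mu set0 = 0%E.
Proof.
apply: integral0_eq => w _; rewrite /density big1// => i _.
by rewrite indic0 mulr0.
Qed.

Let mu_ge0 A : (0 <= mu A)%E.
Proof. by apply: integral_ge0 => w _; rewrite lee_fin density_ge0. Qed.

Let mu_sigma_additive : semi_sigma_additive mu.
Proof.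
move=> F mF tF mUF.
have -> : mu (\bigcup_k F k) = (\sum_(0 <= k <oo) mu (F k))%E.
  rewrite /mu -integral_nneseries//; first last.
  - by move=> k w _; rewrite lee_fin density_ge0.
  - by move=> k; apply/measurable_EFinP; exact: (density_bounded_rv (mF k)).1.
  apply: eq_integral => w _; rewrite /density -sumEFin.
  under [RHS]eq_eseriesr do rewrite -sumEFin.
  rewrite nneseries_sum; last by move=> i k _; rewrite lee_fin mulr_ge0// indicE.
  apply: eq_bigr => i _; under [RHS]eq_eseriesr do rewrite EFinM.
  rewrite nneseriesZl; last by move=> k _; rewrite lee_fin indicE.
  by rewrite EFinM indic_bigcup.
by apply: is_cvg_nneseries => k _ _; exact: mu_ge0.
Qed.

Lemma finite_extension : exists Pr' : probability (T * nat)%type R,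
  forall A, measurable A ->
    Pr' A = (Ex Pr (fun w => \sum_i p i w * \1_A (w, pickle i)))%:E.
Proof.
pose m := isMeasure.Build _ _ _ mu mu0 mu_ge0 mu_sigma_additive.
pose mm : {measure set (T * nat) -> \bar R} := HB.pack mu m.
have mT : mm setT = 1%E.
  rewrite /mm/= /mu (eq_integral (cst 1%E)).
    by rewrite integral_cst// mul1e; exact: probability_setT.
  by move=> w _; rewrite /density; under eq_bigr do rewrite indicT mulr1; rewrite p_sum.
pose pp := Measure_isProbability.Build _ _ _ mm mT.
pose Pr' : probability (T * nat)%type R := HB.pack mu m pp.
exists Pr' => A mA; rewrite -ExE//; exact: density_bounded_rv.
Qed.

End FiniteExtension.

(** * Bernoulli choices on an extended space *)

Section BernoulliExtension.
Context (R : realType) d (T : measurableType d) (Pr : probability T R) (n : nat).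
Context (X : T -> 'cV[R]_n).
Hypothesis X_rv : random_mx X.
Hypothesis X01 : forall w, unit_box (X w).

Let weight (b : 'I_n -> bool) w := bernoulli_weight (fun v => X w v 0) b.

Lemma weight_ge0 b w : 0 <= weight b w.
Proof.
apply: prodr_ge0 => v _; have /andP[? ?] := X01 w v.
by case: (b v); rewrite ?subr_ge0.
Qed.

Lemma coord_bounded_rv v : bounded_rv (fun w => X w v 0).
Proof. by apply: bounded_rv_unit => [|w]; [exact: X_rv|exact: X01]. Qed.

Lemma weight_bounded_rv b : bounded_rv (weight b).
Proof.
apply: bounded_rv_prod => v; case: (b v); first exact: coord_bounded_rv.
by apply: bounded_rvB; [exact: bounded_rv_cst|exact: coord_bounded_rv].
Qed.

(** The default pattern is for numbers that are not codes, to which the extended measure gives no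
    mass. *)
Let decode (k : nat) : {ffun 'I_n -> bool} := odflt [ffun=> false] (unpickle k).

Let decodeK b : decode (pickle b) = b.
Proof. by rewrite /decode pickleK. Qed.

Definition choice_vec (z : T * nat) : 'cV[R]_n := \col_v (decode z.2 v)%:R.

Lemma choice_vec_random : random_mx choice_vec.
Proof.
move=> v j; rewrite /choice_vec; under eq_fun do rewrite mxE.
by apply: (measurableT_comp (f := fun k : nat => (decode k v)%:R : R) (g := snd)).
Qed.

Lemma choice_vec_binary z : binary_vec (choice_vec z).
Proof. by move=> v; rewrite mxE; case: (decode _ _); [right|left]. Qed.

(** The first component keeps the law [Pr], so means of functions of [X] are unchanged; given [w],
    the second is the code of a pattern drawn with the Bernoulli weights of [X w]. *)
Lemma bernoulli_extension : exists Pr' : probability (T * nat)%type R,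
  [/\ @random_mx _ (T * nat)%type R n 1 (X \o fst),
      forall g : T -> R, bounded_rv g -> Ex Pr' (g \o fst) = Ex Pr g,
      forall b, fine (Pr' (binary_event choice_vec b)) = Ex Pr (weight b) &
      bernoulli_given Pr' choice_vec (X \o fst)].
Proof.
have [Pr' Pr'E] := finite_extension Pr (fun b : {ffun 'I_n -> bool} => weight_bounded_rv b)
  (fun b => weight_ge0 b) (fun w => sum_bernoulli_weight (fun v => X w v 0)).
have mXf : @random_mx _ (T * nat)%type R n 1 (X \o fst).
  by move=> v j; apply: (measurableT_comp (X_rv v j)); exact: measurable_fst.
have fstE (g : T -> R) : bounded_rv g -> Ex Pr' (g \o fst) = Ex Pr g.
  move=> bg.
  have mfst : measurable_fun [set: T * nat] (fst : T * nat -> T) by exact: measurable_fst.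
  pose F : {mfun (T * nat)%type >-> T} :=
    HB.pack (fst : T * nat -> T) (isMeasurableFun.Build _ _ _ _ _ mfst).
  have bgf : bounded_rv (g \o fst : T * nat -> R).
    split; first exact: measurableT_comp bg.1 mfst.
    by have [_ [K gK]] := bg; exists K => z; exact: gK.
  rewrite /Ex /Rintegral; congr fine.
  rewrite -[LHS](@integral_distribution _ _ _ _ _ Pr' F (EFin \o g)).
  - apply: eq_measure_integral => A mA _.
    have mfA : measurable (fst @^-1` A : set (T * nat)).
      by rewrite -[X in measurable X]setTI; exact: measurable_fst.
    apply: etrans (Pr'E _ mfA) _.
    rewrite (_ : (fun w => _) = \1_A); last first.
      apply/funext => w.
      have slice k : \1_(fst @^-1` A) (w, k : nat) = \1_A w :> R.
        by rewrite !indicE; congr (_%:R); apply/idP/idP; rewrite !inE.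
      under eq_bigr do rewrite slice.
      by rewrite -mulr_suml (sum_bernoulli_weight (fun v => X w v 0)) mul1r.
    by rewrite Ex_indic// fineK// fin_num_measure.
  - exact/measurable_EFinP/bg.1.
  - exact: bounded_rv_integrable.
exists Pr'; split => //.
  move=> b; rewrite Pr'E; last by apply: measurable_binary_event; exact: choice_vec_random.
  rewrite /=; congr Ex; apply/funext => w.
  (* [b] is a plain function, whereas the sum runs over finite functions. *)
  pose b0 : {ffun 'I_n -> bool} := [ffun v => b v].
  rewrite (bigD1 b0)//= big1 => [|c cb0].
    rewrite indicE mem_set ?mulr1 ?addr0//.
      by apply: eq_bigr => v _; rewrite ffunE.
    by move=> v; rewrite mxE decodeK ffunE.
  rewrite indicE memNset ?mulr0// => cb; move/eqP: cb0; apply.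
  apply/ffunP => v; have /eqP := cb v.
  by rewrite mxE decodeK eqr_nat ffunE; case: (c v); case: (b v).
split; first exact: choice_vec_binary.
move=> v; split.
- by move=> B mB; exact: (sigma_mx_entry (X := X \o fst)).
- apply: bounded_rv_integrable; split; first exact: mXf.
  by exists 1 => z; have /andP[? ?] := X01 z.1 v; rewrite ger0_norm.
- move=> A XA.
  (* An event known from [X \o fst] is a cylinder over an event of [T]. *)
  have [A0 mA0 AE] : exists2 A0, measurable A0 & A = fst @^-1` A0.
    have sub : sigma_mx (X \o fst) `<=`
        preimage_set_system [set: T * nat] fst (@measurable _ T).
      apply: smallest_sub.
        by apply: sigma_algebra_preimage; exact: sigma_algebra_measurable.
      move=> _ [[i j] _ /= [B mB <-]]; exists ((fun w => X w i j) @^-1` B) => //.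
      by rewrite -[X in measurable X]setTI; exact: X_rv.
    by have [A0 mA0 <-] := sub _ XA; exists A0; rewrite ?setTI.
  have bA0 := @bounded_rv_indic _ _ R _ mA0.
  have mA : measurable A by apply: sigma_mx_measurable XA.
  have mv : measurable [set z | choice_vec z v 0 = 1].
    rewrite -[X in measurable X]setTI.
    by have := choice_vec_random v 0 measurableT (measurable_set1 (1 : R)); exact.
  rewrite Pr'E; last exact: measurableI.
  have -> : (\int[Pr']_(z in A) (coord (X \o fst) v z)%:E)%E =
      (Ex Pr' ((fun w => X w v 0 * \1_A0 w) \o fst))%:E.
    rewrite integral_mkcond/= -ExE; last first.
      split; last first.
        by have [_ [K hK]] := bounded_rvM (coord_bounded_rv v) bA0; exists K => z; exact: hK.
      by apply: measurableT_comp (bounded_rvM (coord_bounded_rv v) bA0).1 _; exact: measurable_fst.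
    apply: eq_integral => z _; rewrite patchE AE /coord/= indicE.
    rewrite (_ : (z \in _) = (z.1 \in A0)); last by apply/idP/idP; rewrite !inE.
    by case: (z.1 \in A0); rewrite ?mulr1 ?mulr0.
  rewrite fstE; last by apply: bounded_rvM => //; exact: coord_bounded_rv.
  congr (_%:E); congr Ex; apply/funext => w.
  rewrite -(sum_bernoulli_weight_coord (fun v => X w v 0) v) mulr_suml [RHS]big_mkcond/=.
  apply: eq_bigr => b _; rewrite AE !indicE !in_setI.
  rewrite (_ : ((w, pickle b) \in _) = b v); last first.
    apply/idP/idP; rewrite inE/= mxE decodeK.
      by case: (b v) => // /eqP; rewrite eq_sym oner_eq0.
    by move=> ->.
  rewrite (_ : ((w, pickle b) \in _) = (w \in A0)); last by apply/idP/idP; rewrite !inE.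
  by case: (b v); rewrite ?mulr0.
Qed.
End BernoulliExtension.
Lemma bernoulli_weight_continuous (R : realType) n (b : 'I_n -> bool) :
  continuous (fun z : 'cV[R]_n => bernoulli_weight (fun v => z v 0) b).
Proof.
move=> z; apply: (@cvg_big _ _ _ _ _ (@mul_continuous R) _ (nbhs z) _ _ _ (nbhs_filter z)) => v _.
have cz : u v 0 @[u --> z] --> z v 0 by exact: coord_continuous.
by case: (b v) => //; apply: cvgB => //; exact: cvg_cst.
Qed.

Lemma bernoulli_weight_norm_le1 (R : realType) n (b : 'I_n -> bool) (z : 'cV[R]_n) :
  unit_box z -> `|bernoulli_weight (fun v => z v 0) b| <= 1.
Proof.
move=> z01; suff /andP[? ?] : 0 <= bernoulli_weight (fun v => z v 0) b <= 1 by rewrite ger0_norm.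
rewrite /bernoulli_weight; elim/big_ind: _ => [|r s /andP[r0 r1] /andP[s0 s1]|v _].
- by rewrite ler01 lexx.
- by rewrite mulr_ge0// mulr_ile1.
- by have /andP[? ?] := z01 v; case: (b v); apply/andP; split; lra.
Qed.

Unset Implicit Arguments.
Theorem theorem2 (R : realType) (d : measure_display) (T : measurableType d)
    (Pr : probability T R) (n : nat) (n_ge3 : (3 <= n)%N)
    (P : 'M[R]_n) (P_stoch : row_stochastic P)
    (lam : 'rV[R]_n) (lam01 : forall v, 0 <= lam 0 v <= 1)
    (alpha : R) (alpha01 : 0 <= alpha <= 1)
    (alpha_nondeg : alpha = 0 -> forall v, lam 0 v < 1)
    (eta0 : 'cV[R]_n) (eta0_01 : unit_box eta0)
    (sigma : 'I_n -> R)
    (Pt : nat -> T -> 'M[R]_n) (eta_nc u eta x y : nat -> T -> 'cV[R]_n)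
    (Pt_rv : forall t, random_mx (Pt t))
    (eta_nc_rv : forall t, random_mx (eta_nc t))
    (x_rv : forall t, random_mx (x t))
    (y_rv : forall t, random_mx (y t))
    (Pt_law : forall t, gossip_law Pr alpha P (Pt t))
    (Pt_indep : independent_family Pr (fun t => sigma_mx (Pt t)))
    (Pt_indep_inputs : independent_pair Pr (sigma_proc setT Pt)
       (sigma_join (sigma_proc setT eta_nc) (sigma_mx (x 0%N))))
    (eta_def : forall t w, eta t w = eta0 + eta_nc t w + u t w)
    (eta01 : forall t w, unit_box (eta t w))
    (x01 : forall t w, unit_box (x t w))
    (x_dyn : forall t w, x t.+1 w =
       diag_mx lam *m Pt t w *m x t w + (1%:M - diag_mx lam) *m eta t w)
    (y01 : forall t w, binary_vec (y t w))
    (u0 : forall t w, u t w = 0)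
    (noise : noise_assumption Pr sigma eta_nc x)
    (acceptance : acceptance_assumption Pr x y)
    (acceptance_indep : independent_acceptances Pr x y)
    (topology : topology_assumption P lam) :
  1%:M - diag_mx lam *m mean_influence alpha P \in unitmx /\
  exists (d' : measure_display) (T' : measurableType d')
         (Pr' : probability T' R) (xoo yoo : T' -> 'cV[R]_n),
    [/\ random_mx xoo, random_mx yoo & cvg_in_distribution Pr Pr' x xoo] /\
    [/\ cvg_in_distribution Pr Pr' y yoo,
        bernoulli_given Pr' yoo xoo,
        mean_vec Pr' yoo = x_star alpha P lam eta0 &
        ergodic_with Pr Pr' y yoo].
Proof.
have eta01' t w : unit_box (eta0 + eta_nc t w).
  by have := eta01 t w; rewrite eta_def u0 addr0.
have x_dyn' t w : x t.+1 w = diag_mx lam *m Pt t w *m x t w +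
    (1%:M - diag_mx lam) *m (eta0 + eta_nc t w).
  by rewrite x_dyn eta_def u0 addr0.
have EFin_cvg (u_ : nat -> R) (l : R) :
    u_ t @[t --> \oo] --> l -> (u_ t)%:E @[t --> \oo] --> l%:E.
  by move=> ul; apply: cvg_EFin ul; exact: nearW.
split; first exact: unitmx_resolvent.
pose X := limit_state P lam eta0 Pt eta_nc.
have mX : random_mx X by exact: limit_state_random.
have X01 w : unit_box (X w) by exact: limit_state_unit_box.
have bX v : bounded_rv (fun w => X w v 0) by exact: coord_bounded_rv.
have XE v : Ex Pr (fun w => X w v 0) = x_star alpha P lam eta0 v 0.
  by apply: (limit_state_mean (sigma := sigma) (x := x)).
have xX (f : 'cV[R]_n -> R) (K : R) : continuous f -> (forall z, unit_box z -> `|f z| <= K) ->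
    bounded_rv (f \o X) /\ (forall t, bounded_rv (f \o x t)) /\
    Ex Pr (f \o x t) @[t --> \oo] --> Ex Pr (f \o X).
  move=> cf fK; exact: (state_cvg_law P_stoch lam01 alpha01 alpha_nondeg eta0_01 Pt_rv eta_nc_rv
    x_rv Pt_law Pt_indep Pt_indep_inputs eta01' x01 x_dyn' noise topology cf fK).
have [Pr' [mXf fstE choiceE given]] := bernoulli_extension Pr mX X01.
have mY : random_mx (@choice_vec R _ T n) by exact: choice_vec_random.
have Y01 := @choice_vec_binary R _ T n.
have meanE : mean_vec Pr' (@choice_vec R _ T n) = x_star alpha P lam eta0.
  apply/matrixP => v j; rewrite ord1 mxE.
  have [bc cE] := Ex_binary Y01 Pr' (fun z : 'cV[R]_n => z v 0) mY.
  rewrite (expectation_Ex Pr' bc) /= cE -XE.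
  have -> : (fun w => X w v 0) = fun w => \sum_(b : {ffun 'I_n -> bool} | b v)
      bernoulli_weight (fun u => X w u 0) b.
    by apply/funext => w; rewrite (sum_bernoulli_weight_coord (fun u => X w u 0)).
  rewrite Ex_sum; last by move=> b _; exact: weight_bounded_rv.
  rewrite [RHS]big_mkcond/=; apply: eq_bigr => b _; rewrite mxE choiceE.
  by case: (b v); rewrite ?mul1r ?mul0r.
exists _, (T * nat)%type, Pr', (X \o fst), (@choice_vec R _ T n).
split; split => //.
- move=> f cf [K fK]; have [bf [bfx fx]] := xX f K cf (fun z _ => fK z).
  under eq_fun do rewrite (expectation_Ex Pr (bfx _)).
  have bff : bounded_rv (f \o X \o fst : T * nat -> R).
    split; last by exists K => z; exact: fK.
    by apply: measurableT_comp bf.1 _; exact: measurable_fst.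
  rewrite (expectation_Ex Pr' bff) fstE//.
  exact: EFin_cvg fx.
(* Both vectors are binary, so the two expectations are the same combination of pattern
   probabilities. These are the means of the Bernoulli weights of [x t] and of [X], to which the
   convergence of the states applies. *)
- move=> g cg _.
  have [bg gE] := Ex_binary Y01 Pr' g mY.
  have gy t := Ex_acceptance x_rv y_rv y01 acceptance_indep t g.
  under eq_fun do rewrite (expectation_Ex Pr (gy _).1) (gy _).2.
  rewrite (expectation_Ex Pr' bg) gE.
  apply: EFin_cvg.
  apply: cvg_big => [|b _]; first exact: add_continuous.
  apply: cvgMr; rewrite choiceE.
  have [_ [_ h]] := xX (fun z => bernoulli_weight (fun v => z v 0) b) 1
    (@bernoulli_weight_continuous R n b) (@bernoulli_weight_norm_le1 R n b).
  exact: h.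
- apply: filterS2 (acceptance_average_ae x_rv y_rv x01 y01 acceptance_indep)
    (state_average_ae P_stoch lam01 alpha01 alpha_nondeg eta0_01 Pt_rv eta_nc_rv x_rv
       Pt_law Pt_indep Pt_indep_inputs eta01' x01 x_dyn' noise topology) => w yx xs.
  rewrite meanE; apply: cvg_mx => v j; rewrite ord1.
  have h := cvgD (yx v) (xs v); rewrite add0r in h.
  under eq_fun => t do rewrite mxE summxE.
  have avgE t : t%:R^-1 * (\sum_(l < t) y l w v 0) =
      t%:R^-1 * (\sum_(l < t) (y l w v 0 - x l w v 0)) + t%:R^-1 * (\sum_(l < t) x l w v 0).
    by rewrite sumrB mulrBr subrK.
  by under eq_fun do rewrite avgE; exact: h.
Qed.
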